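(* For a fixed $n$, the Hilbert basis for the semigroup in $\mathrm{QSym}/\mathfrak{m}^2$ generated (under addition) by the set $$S=\{\overline{F(M_\lambda)} : \lambda\vdash n,\ \ell(\lambda)\ge3\}$$ is indexed by those $M_\lambda$ for which $\ell(\lambda)=3$. That is, the map $\lambda\mapsto\overline{F(M_\lambda)}$ is a bijection from the set of partitions of $n$ with exactly three parts onto the Hilbert basis (minimal generating set) of this semigroup.
   Context: A composition is a finite sequence $\alpha=(\alpha_1,\dots,\alpha_m)$ of positive integers, with weight $|\alpha|=\sum\alpha_i$. For compositions of the same weight $n$, $\beta\preccurlyeq\alpha$ ($\beta$ refines $\alpha$) if the set of proper partial sums of $\alpha$ is contained in that of $\beta$. $\mathrm{QSym}$ is the ring of quasisymmetric functions with rational coefficients in ordered variables $x_1,x_2,\dots$, with monomial basis $\mathbf{x}^\alpha=\sum_{i_1<\cdots<i_m}x_{i_1}^{\alpha_1}\cdots x_{i_m}^{\alpha_m}$ and fundamental basis $L_\alpha=\sum_{\beta\preccurlyeq\alpha}\mathbf{x}^\beta$. $\mathrm{QSym}_d$ is its homogeneous component of degree $d$, and $\mathfrak{m}=\bigoplus_{d\ge1}\mathrm{QSym}_d$. For $f\in\mathrm{QSym}$, $\overline{f}$ is its image in $\mathrm{QSym}/\mathfrak{m}^2$. For a poset $P$ on a finite set of positive integers (a labeled poset), $F(P)=\sum_\pi L_{C(\pi)}$, summed over all linear extensions $\pi$ of $P$ (sequences listing each label once, with $x$ before $y$ whenever $x<_P y$), where $C(\pi)$ is the composition of lengths of successive maximal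 increasing runs of $\pi$. For a matroid $M$ with ground set $E(M)$ and bases $\mathcal{B}(M)$, and $B\in\mathcal{B}(M)$, let $P_B$ be the poset on $E(M)$ with $e<_{P_B}e'$ iff $e\in B$, $e'\notin B$ and $(B\setminus\{e\})\cup\{e'\}\in\mathcal{B}(M)$, given any strict labeling (i.e. one for which $x<_{P_B}y$ implies label of $x$ $>$ label of $y$; the choice does not affect $F(P_B)$). Then $F(M)=\sum_{B\in\mathcal{B}(M)}F(P_B)$; it depends only on the isomorphism class of $M$. For a partition $\lambda=(\lambda_1,\dots,\lambda_m)$ of $n$ with $m=\ell(\lambda)\ge2$ parts, $M_\lambda$ is the loopless rank two matroid on $n$ elements (unique up to isomorphism) having exactly $m$ parallelism classes, of cardinalities $\lambda_1,\dots,\lambda_m$. The Hilbert basis of the semigroup is its minimal generating set (a generating set contained in every generating set). *)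

(* Defs.v *)
From HB Require Import structures.
From mathcomp Require Import all_boot all_order all_algebra finmap.
From mathcomp Require Import ring_quotient.
From mathcomp Require Import boolp classical_sets functions cardinality fsbigop.

Set Implicit Arguments.
Unset Strict Implicit.
Unset Printing Implicit Defensive.

Import GRing.Theory.
Local Open Scope classical_set_scope.
Local Open Scope ring_scope.

(** * Compositions *)

Definition is_composition (n : nat) (a : seq nat) : bool :=
  all (ltn 0) a && (sumn a == n).

Definition proper_partial_sums (a : seq nat) : seq nat :=
  [seq sumn (take i a) | i <- iota 1 (size a).-1].

(* [refines b a] is [b ≼ a]. *)
Definition refines (b a : seq nat) : bool :=
  (sumn b == sumn a) && all (mem (proper_partial_sums b)) (proper_partial_sums a).

(* Lengths of the successive maximal increasing runs of a word. *)
Fixpoint run_composition (s : seq nat) : seq nat :=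
  if s is x :: s' then
    if s' is y :: _ then
      if (x < y)%N then
        if run_composition s' is r :: rs then r.+1 :: rs else [::]
      else 1%N :: run_composition s'
    else [:: 1%N]
  else [::].

Definition is_partition (n : nat) (la : seq nat) : bool :=
  sorted geq la && is_composition n la.

(** * Quasisymmetric functions *)

(* A monomial is given by its exponents; the ordered variables are indexed by
   nat, starting from 0. *)
Definition monomial := {fsfun nat -> nat with 0%N}.

Definition mdegree (m : monomial) : nat := (\sum_(i <- finsupp m) m i)%N.

(* The positive exponents of a monomial, in increasing order of the variables:
   [exponents (x_{i_1}^{a_1} ... x_{i_k}^{a_k}) = (a_1, ..., a_k)] for
   [i_1 < ... < i_k] and positive [a_j]. *)
Definition exponents (m : monomial) : seq nat :=
  [seq m i | i <- sort leq (finsupp m)].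

Definition pseries := monomial -> rat.

Definition factorizations (m : monomial) : set (monomial * monomial) :=
  [set p : monomial * monomial | forall i, m i = (p.1 i + p.2 i)%N].

(* The index set is finite, so this [\sum_(_ \in _)] has no junk value; the same
   holds for [fundamental] below. *)
Definition psmul (f g : pseries) : pseries :=
  fun m => \sum_(p \in factorizations m) f p.1 * g p.2.

Definition quasisymmetric (f : pseries) : Prop :=
  (exists d, forall m, f m != 0 -> (mdegree m <= d)%N) /\
  (forall m m', exponents m = exponents m' -> f m = f m').

Definition quasisym : {pred pseries} := [pred f | `[< quasisymmetric f >]].

Lemma quasisym_zmod_closed : zmod_closed quasisym.
Proof.
split=> [|f g /asboolP[[d fd] fs] /asboolP[[e ge] gs]]; apply/asboolP; split.
- by exists 0%N => m; rewrite eqxx.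
- by [].
- exists (maxn d e) => m fgm; rewrite leq_max.
  have [fm0|/fd -> //] := eqVneq (f m) 0.
  have [gm0|/ge -> //] := eqVneq (g m) 0; last by rewrite orbT.
  by move: fgm; rewrite !fctE fm0 gm0 subrr eqxx.
- by move=> m m' mm'; rewrite !fctE (fs _ _ mm') (gs _ _ mm').
Qed.

HB.instance Definition _ :=
  GRing.isZmodClosed.Build pseries quasisym quasisym_zmod_closed.

Record QSym := MkQSym { qval :> pseries; qvalP : qval \in quasisym }.

HB.instance Definition _ := [isSub for qval].
HB.instance Definition _ := [Choice of QSym by <:].
HB.instance Definition _ := [SubChoice_isSubZmodule of QSym by <:].

Lemma mdegreeE (m : monomial) : mdegree m = sumn (exponents m).
Proof.
rewrite sumnE big_map /mdegree; apply: perm_big.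
by rewrite perm_sym perm_sort.
Qed.

Definition monomial_series (a : seq nat) : pseries :=
  fun m => (exponents m == a)%:R.

Lemma monomial_series_quasisym a : monomial_series a \in quasisym.
Proof.
apply/asboolP; split=> [|m m' mm']; last by rewrite /monomial_series mm'.
exists (sumn a) => m; rewrite /monomial_series mdegreeE.
by case: (exponents m =P a) => [->|_]; rewrite ?eqxx.
Qed.

(* [Mon a] is the monomial function [x^a] when the entries of [a] are positive. *)
Definition Mon (a : seq nat) : QSym := MkQSym (monomial_series_quasisym a).

Definition fundamental (a : seq nat) : QSym :=
  \sum_(b \in [set b | is_composition (sumn a) b /\ refines b a]) Mon b.

Definition homogeneous (d : nat) (f : QSym) : Prop :=
  forall m, qval f m != 0 -> mdegree m = d.

Definition in_m (f : QSym) : Prop :=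
  exists (k : nat) (g : nat -> QSym),
    (forall d, homogeneous d (g d)) /\ f = \sum_(1 <= d < k) g d.

(* The product of two quasisymmetric functions is computed among power
   series; [m^2] consists of the finite sums of products of two elements of
   [m]. *)
Definition in_m2 (f : QSym) : Prop :=
  exists s : seq (QSym * QSym),
    (forall p, p \in s -> in_m p.1 /\ in_m p.2) /\
    qval f = \sum_(p <- s) psmul p.1 p.2.

Definition m2 : {pred QSym} := [pred f | `[< in_m2 f >]].

Lemma psmulNl (f g : pseries) : psmul (- f) g = - psmul f g.
Proof.
apply/funext => m; have -> : (- psmul f g) m = - psmul f g m by [].
rewrite /psmul -sumrN.
congr (\sum_(i <- _) _); last by apply/funext => p; rewrite -mulNr.
rewrite /finite_support !unlock; congr fset_set.
apply/seteqP; split=> p [pm] /= fg; split=> //= fg0; apply: fg.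
  by rewrite (mulNr (f p.1) (g p.2)) fg0 oppr0.
by apply/eqP; rewrite -oppr_eq0 -mulNr; apply/eqP.
Qed.

Lemma homogeneousN d f : homogeneous d f -> homogeneous d (- f).
Proof. by move=> hf m; rewrite -[qval (- f) m]/(- qval f m) oppr_eq0 => /hf. Qed.

Lemma in_mN f : in_m f -> in_m (- f).
Proof.
move=> [k [g [hg ->]]]; exists k, (fun d => - g d).
by split=> [d|]; [exact: homogeneousN | rewrite sumrN].
Qed.

Lemma m2_zmod_closed : zmod_closed m2.
Proof.
split=> [|f g /asboolP[s [sm fE]] /asboolP[t [tm gE]]]; apply/asboolP.
  by exists [::]; split=> //; rewrite big_nil.
exists (s ++ [seq (- p.1, p.2) | p : QSym * QSym <- t]); split.
  move=> p; rewrite mem_cat => /orP[/sm //|/mapP[q /tm [q1 q2] ->]].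
  by split=> //; exact: in_mN.
rewrite big_cat big_map /= -fE; congr (_ + _).
by rewrite gE -sumrN; apply: eq_bigr => p _; rewrite psmulNl.
Qed.

HB.instance Definition _ := GRing.isZmodClosed.Build QSym m2 m2_zmod_closed.

Definition QSym_mod_m2 : zmodType := Quotient.quot m2.

Definition bar (f : QSym) : QSym_mod_m2 := \pi_(Quotient.quot m2)%qT f.

(** * Labeled posets *)

(* A labeled poset is a finite type with a strict order [lt] and an injective
   labeling [w] of its elements by positive integers. *)
Definition linear_extension (E : finType) (lt : rel E) (s : seq E) : Prop :=
  [/\ uniq s, forall x, x \in s &
      forall x y, lt x y -> (index x s < index y s)%N].

Definition poset_qsym (E : finType) (lt : rel E) (w : E -> nat) : QSym :=
  \sum_(s : #|E|.-tuple E | `[< linear_extension lt s >])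
     fundamental (run_composition [seq w x | x <- s]).

Definition strict_labeling (E : finType) (lt : rel E) (w : E -> nat) : Prop :=
  [/\ forall x, (0 < w x)%N, injective w &
      forall x y, lt x y -> (w y < w x)%N].

(** * Matroids *)

Record matroid (E : finType) := Matroid {
  bases : {set {set E}};
  bases_neq0 : exists B, B \in bases;
  bases_exchange : forall A B, A \in bases -> B \in bases ->
    forall a, a \in A :\: B ->
    exists2 b, b \in B :\: A & (b |: (A :\ a))%SET \in bases }.

Section MatroidNotions.
Variables (E : finType) (M : matroid E).

Definition independent (I : {set E}) : bool :=
  [exists B in bases M, I \subset B].

Definition rank : nat := \max_(B in bases M) #|B|.

Definition loop (e : E) : bool := ~~ independent [set e]%SET.

Definition parallel (e f : E) : bool :=
  (e == f) || ~~ independent [set e; f]%SET.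

(* Parallelism is an equivalence relation on the elements that are not loops. *)
Definition parallel_classes : {set {set E}} :=
  equivalence_partition parallel [set e | ~~ loop e]%SET.

Definition basis_lt (B : {set E}) : rel E :=
  [rel e e' | [&& e \in B, e' \notin B & (e' |: (B :\ e))%SET \in bases M]].

(* [w B] labels the poset [P_B]. *)
Definition matroid_qsym (w : {set E} -> E -> nat) : QSym :=
  \sum_(B in bases M) poset_qsym (basis_lt B) (w B).

Definition strict_basis_labeling (w : {set E} -> E -> nat) : Prop :=
  forall B, B \in bases M -> strict_labeling (basis_lt B) (w B).

(* Defining property of the matroid [M_la]. *)
Definition is_rank_two_matroid (la : seq nat) : Prop :=
  [/\ forall e, ~~ loop e, rank = 2%N &
      perm_eq [seq #|C : {set E}| | C <- enum parallel_classes] la].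

End MatroidNotions.

(** * Semigroups *)

(* Nonempty sums only: 0 is not adjoined. *)
Definition add_closed (V : zmodType) (A : set V) : Prop :=
  forall x y, A x -> A y -> A (x + y).

Definition semigroup_gen (V : zmodType) (S : set V) : set V :=
  smallest (@add_closed V) S.

Definition is_hilbert_basis (V : zmodType) (A H : set V) : Prop :=
  semigroup_gen H = A /\ forall G, semigroup_gen G = A -> H `<=` G.

(* Main.v *)
(** Two elements of the ground set form a basis of [M_la] when they lie in
    different parallelism classes, and the poset [P_B] of a basis [B = {a, b}] only
    depends on the sizes of the classes of [a] and [b].  Splitting its colourings
    according to which of [a] and [b] has the smaller colour gives
    [F(M_la) = \sum_s h(s)], summed over the parts [s] of [la], where [h] depends
    on [n] only.  As [F(M_(s, n - s))] is a product, [h(s) + h(n - s)] vanishes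
    modulo [m^2], so that [F(M_(a, b, la)) = F(M_(a + b, la)) + F(M_(a, b, |la|))] in
    [QSym / m^2], and the matroids with three classes generate.

    That they form a minimal generating set, without repetitions, is seen with a
    linear form vanishing on [m^2], with values in the polynomials in [x = 1 + t].
    It pairs QSym with the primitive series [H (H_t' H_t^-1) H^-1] of
    noncommutative symmetric functions, where [H = \sum_k H_k],
    [H_t = \sum_k t^k H_k] and the derivative is taken in [t].  Its value on
    [F(M_la)] is, up to sign,
    [\sum_s s (n - s) (x^(n-s-1) - x^(s-1) + s - n / 2)].
    Integrating over [[0, 1]] and subtracting the value at [1] gives a multiple of
    [l(la) - 2]: three-part partitions have degree one, and cannot be decomposed.
    The leading coefficients recover the two smallest parts of a three-part
    partition. *)

Require Import Defs.
From HB Require Import structures.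
From mathcomp Require Import all_boot all_order all_algebra finmap.
From mathcomp Require Import ring_quotient.
From mathcomp Require Import boolp classical_sets functions cardinality fsbigop.
From mathcomp Require Import zify ring.

Set Implicit Arguments.
Unset Strict Implicit.
Unset Printing Implicit Defensive.

Import Order.TTheory GRing.Theory Num.Theory.
Local Open Scope classical_set_scope.
Local Open Scope ring_scope.

(** * Functions on words and their quasi-shuffle product *)

Section WordFunctions.
Variable R : comNzRingType.
Implicit Types (A B : seq nat -> R) (Z : (seq nat -> R) -> R) (t : R).

(** A word stands for a list of exponents and [A] for the coefficients of a power series.
    [shift A c] is the coefficient of the [c]-th power of the first variable; on functionals it is
    dual to left multiplication by [H_c]. *)
Definition shift A (c : nat) : seq nat -> R := fun al => A (c :: al).

(** Product of power series, computed one variable at a time; on quasisymmetric coefficients it is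
    the product of QSym. *)
Fixpoint qmul A B (al : seq nat) : R :=
  if al is b :: al' then
    \sum_(c < b.+1) qmul (shift A c) (shift B (b - c)) al'
  else A [::] * B [::].

(** Quasisymmetry, in the form that zero exponents can be deleted. It makes [shift A 0] equal to
    [A], which is dual to [H_0 = 1]. *)
Definition zero_skipping A := forall be al, A (be ++ 0%N :: al) = A (be ++ al).

Definition degree_le D A := forall al, (D < sumn al)%N -> A al = 0.

Definition linear_fun Z :=
  forall k A B, Z (fun al => k * A al + B al) = k * Z A + Z B.

Lemma linear_fun0 Z : linear_fun Z -> Z (fun=> 0) = 0.
Proof.
move=> Zl; have := Zl (-1) (fun=> 0) (fun=> 0).
under eq_fun do rewrite mulr0 addr0.
by rewrite mulN1r addNr.
Qed.

Lemma linear_funZ Z k A : linear_fun Z -> Z (fun al => k * A al) = k * Z A.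
Proof.
move=> Zl; have := Zl k A (fun=> 0).
by under eq_fun do rewrite addr0; rewrite linear_fun0 // addr0.
Qed.

Lemma linear_funD Z A B : linear_fun Z ->
  Z (fun al => A al + B al) = Z A + Z B.
Proof.
move=> Zl; have := Zl 1 A B.
by under eq_fun do rewrite mul1r; rewrite mul1r.
Qed.

Lemma linear_fun_sum Z (I : Type) (s : seq I) (P : pred I)
    (F : I -> seq nat -> R) :
  linear_fun Z ->
  Z (fun al => \sum_(i <- s | P i) F i al) = \sum_(i <- s | P i) Z (F i).
Proof.
move=> Zl; elim: s => [|i s IHs].
  by under eq_fun do rewrite big_nil; rewrite big_nil linear_fun0.
under eq_fun do rewrite big_cons; rewrite big_cons.
by case: (P i) => //; rewrite linear_funD // IHs.
Qed.

Lemma shift0 A : zero_skipping A -> shift A 0 = A.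
Proof. by move=> Az; apply/funext => al; exact: (Az [::]). Qed.

Lemma zero_skipping_shift A c : zero_skipping A -> zero_skipping (shift A c).
Proof. by move=> Az be al; exact: (Az (c :: be)). Qed.

Lemma degree_le_shift D A c : degree_le D A -> degree_le (D - c) (shift A c).
Proof. by move=> AD al Dal; apply: AD => /=; lia. Qed.

Lemma shift_eq0 D A c : degree_le D A -> (D < c)%N -> shift A c = fun=> 0.
Proof. by move=> AD Dc; apply/funext => al; apply: AD => /=; lia. Qed.

Lemma degree_leW D D' A : (D <= D')%N -> degree_le D A -> degree_le D' A.
Proof. by move=> DD' AD al al'; apply: AD; lia. Qed.

Lemma qmul0l B : qmul (fun=> 0) B = fun=> 0.
Proof.
apply/funext => al; elim: al B => [|b al IHal] B /=; first by rewrite mul0r.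
by rewrite big1 // => c _; exact: IHal.
Qed.

Lemma qmul0r A : qmul A (fun=> 0) = fun=> 0.
Proof.
apply/funext => al; elim: al A => [|b al IHal] A /=; first by rewrite mulr0.
by rewrite big1 // => c _; exact: IHal.
Qed.

Lemma qmulZl k A B : qmul (fun al => k * A al) B = fun al => k * qmul A B al.
Proof.
apply/funext => al; elim: al A B => [|b al IHal] A B /=; first by rewrite mulrA.
by rewrite mulr_sumr; apply: eq_bigr => c _; rewrite -IHal.
Qed.

Lemma qmulZr k A B : qmul A (fun al => k * B al) = fun al => k * qmul A B al.
Proof.
apply/funext => al; elim: al A B => [|b al IHal] A B /=; first by rewrite mulrCA.
by rewrite mulr_sumr; apply: eq_bigr => c _; rewrite -IHal.
Qed.

Lemma shift_qmul A B c : shift (qmul A B) c =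
  fun al => \sum_(d < c.+1) qmul (shift A d) (shift B (c - d)) al.
Proof. by []. Qed.

Lemma zero_skipping_qmul A B :
  zero_skipping A -> zero_skipping B -> zero_skipping (qmul A B).
Proof.
move=> Az Bz be; elim: be A B Az Bz => [|b be IHbe] A B Az Bz al.
  by rewrite /= big_ord1 subn0 !shift0.
by apply: eq_bigr => c _; apply: IHbe; exact: zero_skipping_shift.
Qed.

Lemma degree_le_qmul D D' A B :
  degree_le D A -> degree_le D' B -> degree_le (D + D') (qmul A B).
Proof.
move=> AD BD al; elim: al D D' A B AD BD => [|b al IHal] D D' A B AD BD //= Dal.
apply: big1 => c _; have [Dc|cD] := ltnP D c.
  by rewrite (shift_eq0 AD Dc) qmul0l.
have [Dc'|cD'] := ltnP D' (b - c).
  by rewrite (shift_eq0 BD Dc') qmul0r.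
apply: (IHal (D - c)%N (D' - (b - c))%N); try exact: degree_le_shift.
by have := ltn_ord c; lia.
Qed.

(** The vanishing of [G] beyond total degree [N] lets the triangle be completed to a square, whose
    sum can then factorise. *)
Lemma sum_triangle N (G : nat -> nat -> R) :
  (forall d e, (N < d + e)%N -> G d e = 0) ->
  \sum_(c < N.+1) \sum_(d < c.+1) G d (c - d)%N =
  \sum_(d < N.+1) \sum_(e < N.+1) G d e.
Proof.
move=> G0; pose H c d := if (d <= c)%N then G d (c - d)%N else 0.
transitivity (\sum_(c < N.+1) \sum_(d < N.+1) H c d).
  apply: eq_bigr => c _.
  rewrite -(big_mkord xpredT (fun d => G d (c - d)%N)).
  rewrite -(big_mkord xpredT (H c)) [RHS](big_cat_nat (n := c.+1)) //=.
  rewrite [X in _ + X]big1_seq ?addr0.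
    by apply: eq_big_nat => d /andP[_]; rewrite ltnS /H => ->.
  by move=> d; rewrite mem_index_iota /H => /andP[_ /andP[]]; case: leqP => //; lia.
rewrite exchange_big; apply: eq_bigr => d _.
rewrite -(big_mkord xpredT (fun c => H c d)) (big_cat_nat (n := d)) //=; last first.
  by have := ltn_ord d; lia.
rewrite [X in X + _]big1_seq ?add0r; last first.
  by move=> c; rewrite mem_index_iota /H => /andP[_ /andP[]]; case: leqP => //; lia.
rewrite -{1}[d : nat]add0n big_addn.
rewrite -(big_mkord xpredT (G d)) [RHS](big_cat_nat (n := (N.+1 - d)%N)) //=; last first.
  by lia.
rewrite [X in _ = _ + X]big1_seq ?addr0; last first.
  by move=> e; rewrite mem_index_iota => /andP[_ /andP[]] *; apply: G0; lia.
by apply: eq_big_nat => e _; rewrite /H leq_addl addnK.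
Qed.

(** * Division of a functional by the generating series [H_t] *)

Section Truncated.
Variable N : nat.

(* On zero-skipping [A] of degree at most [k, N], the functional
   [Z' := unfold Z t k] is the solution of [\sum_(c >= 0) t ^+ c * Z' (shift A c) = Z A]. *)
Fixpoint unfold Z t (k : nat) A : R :=
  if k is k'.+1 then
    Z A - \sum_(c < N) t ^+ c.+1 * unfold Z t k' (shift A c.+1)
  else Z A.

Lemma linear_unfold Z t k : linear_fun Z -> linear_fun (unfold Z t k).
Proof.
move=> Zl; elim: k => [//|k IHk] x A B /=; rewrite Zl.
under eq_bigr => c _ do rewrite IHk mulrDr mulrCA.
by rewrite big_split /= -mulr_sumr; ring.
Qed.

(** Each shift by a positive exponent lowers the degree, so recursion deeper than the degree only
    adds zero terms. *)
Lemma unfold_stable Z t k A : linear_fun Z -> degree_le k A ->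
  unfold Z t k.+1 A = unfold Z t k A.
Proof.
move=> Zl; elim: k A => [|k IHk] A Ak.
  rewrite /= big1 ?subr0 // => c _.
  by rewrite (shift_eq0 Ak) // linear_fun0 // mulr0.
rewrite {1}[unfold]lock /= -lock.
rewrite -/(unfold Z t k.+2 A) [LHS]/=; congr (_ - _); apply: eq_bigr => c _.
rewrite -IHk //; apply: degree_leW (degree_le_shift (c := c.+1) Ak); lia.
Qed.

Lemma unfold_eq Z t k A : linear_fun Z -> zero_skipping A -> degree_le k A ->
  \sum_(c < N.+1) t ^+ c * unfold Z t k (shift A c) = Z A.
Proof.
move=> Zl Az Ak; rewrite big_ord_recl /= expr0 mul1r shift0 //.
by rewrite -unfold_stable //= addrNK.
Qed.

(** [H_t] is group-like, so dividing a multiplicative functional by it keeps it multiplicative. Both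
    sides are expanded by [unfold_eq]; the terms of positive total shift agree by induction on
    [D + D'], and cancelling them leaves the claim. *)
Lemma unfoldM Z t k A B D D' : linear_fun Z ->
  (forall A' B', zero_skipping A' -> zero_skipping B' ->
     degree_le D A' -> degree_le D' B' -> Z (qmul A' B') = Z A' * Z B') ->
  zero_skipping A -> zero_skipping B -> degree_le D A -> degree_le D' B ->
  (D + D' <= k)%N -> (D + D' <= N)%N ->
  unfold Z t k (qmul A B) = unfold Z t k A * unfold Z t k B.
Proof.
move=> Zl; have [m] := ubnP (D + D')%N.
elim: m D D' A B => [//|m IHm] D D' A B Dm ZM Az Bz AD BD Dk DN.
have Ul : linear_fun (unfold Z t k) by exact: linear_unfold.
have U0 := linear_fun0 Ul.
have ABz := zero_skipping_qmul Az Bz.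
have ABD : degree_le k (qmul A B).
  by apply: degree_leW (degree_le_qmul AD BD).
have := unfold_eq t Zl ABz ABD; rewrite ZM //.
have Ak : degree_le k A by apply: degree_leW AD; lia.
have Bk : degree_le k B by apply: degree_leW BD; lia.
rewrite -(unfold_eq t Zl Az Ak) -(unfold_eq t Zl Bz Bk) big_distrlr /=.
pose G d e := t ^+ d * unfold Z t k (shift A d) * (t ^+ e * unfold Z t k (shift B e)).
have G0 d e : (N < d + e)%N -> G d e = 0.
  rewrite /G => Nde; have [Dd|dD] := ltnP D d.
    by rewrite (shift_eq0 AD Dd) U0 mulr0 mul0r.
  by rewrite (shift_eq0 BD) ?U0 ?mulr0 //; lia.
rewrite -(sum_triangle G0) big_ord_recl [RHS]big_ord_recl /= big_ord1.
rewrite {1}/G !expr0 !mul1r !shift0 //.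
rewrite (eq_bigr (fun i : 'I_N => \sum_(d < i.+2) G d (i.+1 - d)%N)); first exact: addIr.
move=> c _; rewrite shift_qmul linear_fun_sum // mulr_sumr.
apply: eq_bigr => d _; have dc := ltn_ord d.
rewrite /G mulrACA -exprD subnKC; last by rewrite -ltnS.
congr (_ * _).
have [Dd|dD] := ltnP D d; first by rewrite (shift_eq0 AD Dd) qmul0l U0 mul0r.
have [De|eD] := ltnP D' (c.+1 - d).
  by rewrite (shift_eq0 BD De) qmul0r U0 mulr0.
apply: (IHm (D - d)%N (D' - (c.+1 - d))%N);
  try exact: zero_skipping_shift; try exact: degree_le_shift; try lia.
move=> A' B' A'z B'z A'D B'D.
by apply: ZM => //; [apply: degree_leW A'D | apply: degree_leW B'D]; lia.
Qed.

End Truncated.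
End WordFunctions.

(** * An infinitesimal character *)

Section Words.
Variable R : comNzRingType.
Implicit Types (A B : seq nat -> R).

(** For positive [c], the linear map that prepends the part [c] to each composition in the monomial
    basis. *)
Fixpoint prefix_word (c : nat) A (al : seq nat) : R :=
  if al is d :: al' then
    if d == 0%N then prefix_word c A al' else (d == c)%:R * A al'
  else 0.

(** The coefficients of the [r]-th power of the sum of all variables. *)
Fixpoint multinom (r : nat) (al : seq nat) : R :=
  if al is d :: al' then 'C(r, d)%:R * multinom (r - d) al' else (r == 0%N)%:R.

Lemma shift_prefix_word0 c A : shift (prefix_word c A) 0 = prefix_word c A.
Proof. by []. Qed.

Lemma shift_prefix_word c A : (0 < c)%N -> shift (prefix_word c A) c = A.
Proof.
move=> c0; apply/funext => al; rewrite /shift /= eqxx mul1r.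
by case: eqP c0 => // ->.
Qed.

Lemma shift_prefix_word_neq c d A : (0 < d)%N -> d != c ->
  shift (prefix_word c A) d = fun=> 0.
Proof.
move=> d0 /negPf dc; apply/funext => al; rewrite /shift /= dc mul0r.
by case: eqP d0 => // ->.
Qed.

Lemma shift_multinom r d :
  shift (multinom r) d = fun al => 'C(r, d)%:R * multinom (r - d) al.
Proof. by []. Qed.

Lemma zero_skipping_prefix_word c A :
  zero_skipping A -> zero_skipping (prefix_word c A).
Proof.
move=> Az; elim=> [//|b be IHbe] al /=.
by case: eqP => // _; rewrite Az.
Qed.

Lemma zero_skipping_multinom r : zero_skipping (multinom r).
Proof.
move=> be al; elim: be r => [|b be IHbe] r /=; last by rewrite IHbe.
by rewrite bin0 mul1r subn0.
Qed.

Lemma degree_le_prefix_word c D A :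
  degree_le D A -> degree_le (c + D) (prefix_word c A).
Proof.
move=> AD; elim=> [//|d al IHal] /=.
case: eqP => [->|_ cD]; first by rewrite add0n; exact: IHal.
by case: eqP => [dc|_]; [rewrite AD ?mulr0 //; lia | rewrite mul0r].
Qed.

Lemma degree_le_multinom r : degree_le r (multinom r).
Proof.
move=> al; elim: al r => [//|d al IHal] r /= rd.
have [dr|rd'] := leqP d r; last by rewrite bin_small // mul0r.
by rewrite IHal ?mulr0 //; lia.
Qed.

Lemma qmul_multinom p q : qmul (multinom p) (multinom q) = multinom (p + q).
Proof.
apply/funext => al; elim: al p q => [|c al IHal] p q /=.
  by rewrite -natrM mulnb addn_eq0.
rewrite -binomial.Vandermonde natr_sum mulr_suml.
apply: eq_bigr => d _; rewrite !shift_multinom qmulZl qmulZr IHal.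
have [dp|pd] := leqP d p; last by rewrite bin_small // !mul0r.
have [cq|qc] := leqP (c - d) q; last by rewrite (bin_small qc) muln0 mul0r mulr0 mul0r.
rewrite natrM mulrA; congr (_ * multinom _ _).
by have := ltn_ord d; lia.
Qed.

Lemma multinom1 : multinom 1 = prefix_word 1 (multinom 0).
Proof.
apply/funext; elim=> [//|[|[|d]] al IHal] /=.
- by rewrite bin0 mul1r IHal.
- by [].
- by rewrite bin_small // !mul0r.
Qed.

(* A quasi-shuffle: the first block of a product comes from the left factor,
   from the right one, or from both. *)
Lemma qmul_prefix_word A B : zero_skipping A -> zero_skipping B ->
  qmul (prefix_word 1 A) (prefix_word 1 B) = fun al =>
    prefix_word 1 (qmul A (prefix_word 1 B)) al +
    prefix_word 1 (qmul (prefix_word 1 A) B) al +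
    prefix_word 2 (qmul A B) al.
Proof.
move=> Az Bz; apply/funext; elim=> [|c al IHal] /=; first by rewrite mul0r !addr0.
case: c => [|c] /=; first by rewrite big_ord1 /= -IHal.
rewrite big_ord_recl subn0 shift_prefix_word0 big_ord_recl /=.
rewrite shift_prefix_word // subSS subn0 big1 ?addr0; last first.
  by move=> d _; rewrite [shift _ (bump _ _)]shift_prefix_word_neq // qmul0l.
case: c => [|[|c]].
- by rewrite shift_prefix_word // shift_prefix_word0 !mul1r mul0r addr0 addrC.
- rewrite [shift _ 2]shift_prefix_word_neq // shift_prefix_word //.
  by rewrite qmul0r !mul0r mul1r !add0r.
- rewrite [shift _ c.+3]shift_prefix_word_neq // [shift _ c.+2]shift_prefix_word_neq //.
  by rewrite !qmul0r !mul0r !addr0.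
Qed.

(** * The functionals, their product rules and their values *)

Section Functionals.
Variables (N : nat) (t : R).

Definition constant_term A : R := A [::].
(* The pairings with the series [H^-1], [H_t^-1 H^-1], [H_t' H_t^-1 H^-1] and
   [H H_t' H_t^-1 H^-1]. *)
Definition sign_fun : (seq nat -> R) -> R := unfold N constant_term 1 N.
Definition ideal_fun : (seq nat -> R) -> R := unfold N sign_fun t N.
Definition log_fun A : R :=
  \sum_(c < N.+1) (c%:R * t ^+ c.-1) * ideal_fun (shift A c).
Definition lie_fun A : R := \sum_(c < N.+1) log_fun (shift A c).

Lemma linear_constant_term : linear_fun constant_term. Proof. by []. Qed.

Lemma linear_sign_fun : linear_fun sign_fun.
Proof. exact: linear_unfold. Qed.

Lemma linear_ideal_fun : linear_fun ideal_fun.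
Proof. by apply: linear_unfold; exact: linear_sign_fun. Qed.

Lemma linear_log_fun : linear_fun log_fun.
Proof.
move=> k A B; rewrite /log_fun mulr_sumr -big_split; apply: eq_bigr => c _.
by rewrite [ideal_fun _]linear_ideal_fun /=; ring.
Qed.

Lemma linear_lie_fun : linear_fun lie_fun.
Proof.
move=> k A B; rewrite /lie_fun mulr_sumr -big_split; apply: eq_bigr => c _.
exact: linear_log_fun.
Qed.

Section OneFactor.
Variable A : seq nat -> R.
Hypotheses (Az : zero_skipping A) (AN : degree_le N A).

Lemma sign_fun_eq : \sum_(c < N.+1) sign_fun (shift A c) = A [::].
Proof.
rewrite -[RHS](unfold_eq N 1 linear_constant_term Az AN).
by apply: eq_bigr => c _; rewrite expr1n mul1r.
Qed.

Lemma ideal_fun_eq : \sum_(c < N.+1) t ^+ c * ideal_fun (shift A c) = sign_fun A.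
Proof. exact: (unfold_eq N t linear_sign_fun Az AN). Qed.

End OneFactor.


(** Common form of the next product rules: sorting by the exponents [d] and [e] of the first
    variable in the two factors gives a double sum over [G]. *)
Lemma sum_shift_qmul Z (f : nat -> R) (G : nat -> nat -> R) A B D D' :
  linear_fun Z -> degree_le D A -> degree_le D' B -> (D + D' <= N)%N ->
  (forall d e, (D < d)%N || (D' < e)%N -> G d e = 0) ->
  (forall d e, (d <= D)%N -> (e <= D')%N ->
    f (d + e)%N * Z (qmul (shift A d) (shift B e)) = G d e) ->
  \sum_(c < N.+1) f c * Z (shift (qmul A B) c) =
  \sum_(d < N.+1) \sum_(e < N.+1) G d e.
Proof.
move=> Zl AD BD DN G0 GE.
rewrite -(@sum_triangle R N G); last by move=> d e Nde; apply: G0; lia.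
apply: eq_bigr => c _; rewrite shift_qmul linear_fun_sum // mulr_sumr.
apply: eq_bigr => d _; have [Dd|dD] := ltnP D d.
  by rewrite (shift_eq0 AD Dd) qmul0l linear_fun0 // mulr0 G0 // Dd.
have [De|eD] := ltnP D' (c - d).
  by rewrite (shift_eq0 BD De) qmul0r linear_fun0 // mulr0 G0 // De orbT.
by rewrite -GE // subnKC // -ltnS.
Qed.

Section Product.
Variables (D D' : nat).
Hypothesis DN : (D + D' <= N)%N.

Lemma sign_funM A B : zero_skipping A -> zero_skipping B ->
  degree_le D A -> degree_le D' B ->
  sign_fun (qmul A B) = sign_fun A * sign_fun B.
Proof. by move=> *; apply: (unfoldM 1 (D := D) (D' := D') linear_constant_term). Qed.

Lemma ideal_funM A B : zero_skipping A -> zero_skipping B ->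
  degree_le D A -> degree_le D' B ->
  ideal_fun (qmul A B) = ideal_fun A * ideal_fun B.
Proof.
move=> *; apply: (unfoldM t (D := D) (D' := D') linear_sign_fun) => //.
by move=> *; apply: sign_funM.
Qed.

(** [H_t' H_t^-1] is primitive and [H^-1] is group-like, whence a Leibniz rule twisted by
    [sign_fun]. *)
Lemma log_funM A B : zero_skipping A -> zero_skipping B ->
  degree_le D A -> degree_le D' B ->
  log_fun (qmul A B) = log_fun A * sign_fun B + sign_fun A * log_fun B.
Proof.
move=> Az Bz AD BD; pose f c := c%:R * t ^+ c.-1.
have T0 := linear_fun0 linear_ideal_fun.
pose G d e := (f d * ideal_fun (shift A d)) * (t ^+ e * ideal_fun (shift B e)) +
  (t ^+ d * ideal_fun (shift A d)) * (f e * ideal_fun (shift B e)).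
rewrite /log_fun (sum_shift_qmul (f := f) (G := G) linear_ideal_fun AD BD DN).
- under eq_bigr => d _ do rewrite big_split.
  rewrite big_split /= -!big_distrlr /=.
  have AN : degree_le N A by apply: degree_leW AD; lia.
  have BN : degree_le N B by apply: degree_leW BD; lia.
  by rewrite -(ideal_fun_eq Az AN) -(ideal_fun_eq Bz BN).
- move=> d e /orP[Dd|De]; rewrite /G ?(shift_eq0 AD Dd) ?(shift_eq0 BD De) T0; ring.
- move=> d e dD eD; rewrite [ideal_fun (qmul _ _)]ideal_funM; first last.
  + apply: degree_leW (degree_le_shift (c := e) BD); lia.
  + apply: degree_leW (degree_le_shift (c := d) AD); lia.
  + exact: zero_skipping_shift.
  + exact: zero_skipping_shift.
  (* The Leibniz rule for the derivative of [t ^+ d * t ^+ e]. *)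
  have -> : f (d + e)%N = f d * t ^+ e + t ^+ d * f e.
    rewrite /f; case: d {dD} => [|d]; first by rewrite expr0; ring.
    case: e {eD} => [|e]; first by rewrite addn0 expr0; ring.
    by rewrite natrD -[(d.+1 + e.+1).-1]/(d + e.+1)%N !exprD !exprS /=; ring.
  by rewrite /G; ring.
Qed.

(** Left multiplication by [H] turns [sign_fun] into the constant term, so [lie_fun] is a derivation
    at the augmentation and kills products of functions without constant term. *)
Lemma lie_funM A B : zero_skipping A -> zero_skipping B ->
  degree_le D A -> degree_le D' B ->
  lie_fun (qmul A B) = lie_fun A * B [::] + A [::] * lie_fun B.
Proof.
move=> Az Bz AD BD.
have S0 := linear_fun0 linear_sign_fun; have V0 := linear_fun0 linear_log_fun.
pose G d e := log_fun (shift A d) * sign_fun (shift B e) +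
  sign_fun (shift A d) * log_fun (shift B e).
rewrite /lie_fun; under eq_bigr => c _ do rewrite -[log_fun _]mul1r.
rewrite (sum_shift_qmul (f := fun=> 1) (G := G) linear_log_fun AD BD DN).
- under eq_bigr => d _ do rewrite big_split.
  rewrite big_split /= -!big_distrlr /= !sign_fun_eq //.
  + by apply: degree_leW AD; lia.
  + by apply: degree_leW BD; lia.
- move=> d e /orP[Dd|De]; rewrite /G ?(shift_eq0 AD Dd) ?(shift_eq0 BD De) V0 S0; ring.
- move=> d e dD eD; rewrite mul1r log_funM //; try exact: zero_skipping_shift.
  + apply: degree_leW (degree_le_shift (c := d) AD); lia.
  + apply: degree_leW (degree_le_shift (c := e) BD); lia.
Qed.

End Product.

(** * Values on functions with a prescribed first part *)

Section Prefix.
Variables (c D : nat) (A : seq nat -> R).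
Hypotheses (c_gt0 : (0 < c)%N) (Az : zero_skipping A) (AD : degree_le D A).
Hypothesis cDN : (c + D <= N)%N.

(** Only two exponents contribute: a leading zero is skipped and [c] is stripped off. *)
Lemma sum_shift_prefix_word Z (f : nat -> R) : linear_fun Z ->
  \sum_(d < N.+1) f d * Z (shift (prefix_word c A) d) =
  f 0%N * Z (prefix_word c A) + f c * Z A.
Proof.
move=> Zl; have cN : (c < N.+1)%N by lia.
rewrite (bigD1 ord0) //= (bigD1 (Ordinal cN)) /=; last first.
  by rewrite -val_eqE /= -lt0n.
rewrite shift_prefix_word0 shift_prefix_word // big1 ?addr0 // => d.
rewrite -!val_eqE /= => /andP[d0 dc].
by rewrite shift_prefix_word_neq ?linear_fun0 ?mulr0 // lt0n.
Qed.

Let prefix_z : zero_skipping (prefix_word c A).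
Proof. exact: zero_skipping_prefix_word. Qed.

Let prefix_N : degree_le N (prefix_word c A).
Proof. exact: degree_leW cDN (degree_le_prefix_word AD). Qed.

Lemma sign_fun_prefix : sign_fun (prefix_word c A) = - sign_fun A.
Proof.
have := sign_fun_eq prefix_z prefix_N.
under eq_bigr => d _ do rewrite -[sign_fun _]mul1r.
rewrite (sum_shift_prefix_word (fun=> 1) linear_sign_fun) !mul1r /=.
by move/addr0_eq => <-; rewrite opprK.
Qed.

Lemma ideal_fun_prefix :
  ideal_fun (prefix_word c A) = - sign_fun A - t ^+ c * ideal_fun A.
Proof.
have := ideal_fun_eq prefix_z prefix_N.
rewrite (sum_shift_prefix_word (fun d => t ^+ d) linear_ideal_fun).
by rewrite expr0 mul1r sign_fun_prefix => <-; rewrite addrK.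
Qed.

Lemma log_fun_prefix : log_fun (prefix_word c A) = c%:R * t ^+ c.-1 * ideal_fun A.
Proof.
rewrite /log_fun (sum_shift_prefix_word (fun d => d%:R * t ^+ d.-1) linear_ideal_fun).
by rewrite !mul0r add0r.
Qed.

Lemma lie_fun_prefix : lie_fun (prefix_word c A) =
  c%:R * t ^+ c.-1 * ideal_fun A + log_fun A.
Proof.
rewrite /lie_fun; under eq_bigr => d _ do rewrite -[log_fun _]mul1r.
rewrite (sum_shift_prefix_word (fun=> 1) linear_log_fun).
by rewrite !mul1r log_fun_prefix.
Qed.

End Prefix.

Lemma sum_shift_multinom0 Z (f : nat -> R) : linear_fun Z ->
  \sum_(d < N.+1) f d * Z (shift (multinom 0) d) = f 0%N * Z (multinom 0).
Proof.
move=> Zl; rewrite big_ord_recl /= shift0; last exact: zero_skipping_multinom.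
rewrite big1 ?addr0 // => d _.
by rewrite (shift_eq0 (@degree_le_multinom 0)) ?linear_fun0 ?mulr0.
Qed.

Let multinom0_z : zero_skipping (multinom 0).
Proof. exact: zero_skipping_multinom. Qed.

Let multinom0_N : degree_le N (multinom 0).
Proof. exact: degree_leW (@degree_le_multinom 0). Qed.

Lemma sign_fun_multinom0 : sign_fun (multinom 0) = 1.
Proof.
have := sign_fun_eq multinom0_z multinom0_N.
under eq_bigr => d _ do rewrite -[sign_fun _]mul1r.
by rewrite (sum_shift_multinom0 (fun=> 1) linear_sign_fun) mul1r.
Qed.

Lemma ideal_fun_multinom0 : ideal_fun (multinom 0) = 1.
Proof.
have := ideal_fun_eq multinom0_z multinom0_N.
rewrite (sum_shift_multinom0 (fun d => t ^+ d) linear_ideal_fun).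
by rewrite sign_fun_multinom0 mul1r.
Qed.

(** [multinom r] is the [r]-th power of [multinom 1], so multiplicativity reduces the claim to the
    value at [multinom 1]. The values of [ideal_fun] and [log_fun] below come in the same way from
    their product rules. *)
Lemma sign_fun_multinom r : (r <= N)%N -> sign_fun (multinom r) = (-1) ^+ r.
Proof.
elim: r => [|r IHr] rN; first exact: sign_fun_multinom0.
rewrite -add1n -qmul_multinom (sign_funM (D := 1) (D' := r)) //;
  try exact: zero_skipping_multinom; try exact: degree_le_multinom.
rewrite multinom1 (sign_fun_prefix (D := 0)) //; try lia;
  try exact: degree_le_multinom.
by rewrite sign_fun_multinom0 IHr ?exprS //; lia.
Qed.

Lemma ideal_fun_multinom r : (r <= N)%N ->
  ideal_fun (multinom r) = (- (1 + t)) ^+ r.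
Proof.
elim: r => [|r IHr] rN; first exact: ideal_fun_multinom0.
rewrite -add1n -qmul_multinom (ideal_funM (D := 1) (D' := r)) //;
  try exact: zero_skipping_multinom; try exact: degree_le_multinom.
rewrite multinom1 (ideal_fun_prefix (D := 0)) //; try lia;
  try exact: degree_le_multinom.
rewrite sign_fun_multinom0 ideal_fun_multinom0 IHr ?exprS //; last by lia.
by rewrite expr0; ring.
Qed.

Lemma log_fun_multinom r : (r <= N)%N ->
  log_fun (multinom r) = - r%:R * (-1) ^+ r.
Proof.
elim: r => [|r IHr] rN.
  rewrite /log_fun (sum_shift_multinom0 (fun d => d%:R * t ^+ d.-1) linear_ideal_fun).
  by ring.
rewrite -add1n -qmul_multinom (log_funM (D := 1) (D' := r)) //;
  try exact: zero_skipping_multinom; try exact: degree_le_multinom.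
rewrite multinom1 (sign_fun_prefix (D := 0)) // ?(log_fun_prefix (D := 0)) //; try lia;
  try exact: degree_le_multinom.
rewrite sign_fun_multinom0 ideal_fun_multinom0 IHr ?sign_fun_multinom //; try lia.
by rewrite natrD exprS /= expr0; ring.
Qed.

(** The argument enumerates one lowest element, followed by [p] free elements beside a star with [q]
    leaves. Stripping the first part leaves [ideal_fun] and [log_fun] of a product, to which the
    product rules apply. *)
Lemma lie_fun_star p q : (p + q + 2 <= N)%N ->
  lie_fun (prefix_word 1 (qmul (multinom p) (prefix_word 1 (multinom q)))) =
  (-1) ^+ (p + q) *
    ((1 + t) ^+ q - (1 + t) ^+ p - t * (1 + t) ^+ (p + q) + p%:R).
Proof.
move=> pqN.
have pz := @zero_skipping_multinom p; have pD := @degree_le_multinom p.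
have qz : zero_skipping (prefix_word 1 (multinom q)).
  by apply: zero_skipping_prefix_word; exact: zero_skipping_multinom.
have qD : degree_le (1 + q) (prefix_word 1 (multinom q)).
  by apply: degree_le_prefix_word; exact: degree_le_multinom.
rewrite (lie_fun_prefix (D := (p + (1 + q))%N)) //; try lia;
  try exact: zero_skipping_qmul; try exact: degree_le_qmul.
have DN : (p + (1 + q) <= N)%N by lia.
rewrite (ideal_funM DN) // (log_funM DN) // (ideal_fun_prefix (D := q)) //;
  try exact: zero_skipping_multinom; try exact: degree_le_multinom; try lia.
rewrite (log_fun_prefix (D := q)) // ?(sign_fun_prefix (D := q)) //;
  try exact: zero_skipping_multinom; try exact: degree_le_multinom; try lia.
rewrite !ideal_fun_multinom ?sign_fun_multinom ?log_fun_multinom //; try lia.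
by rewrite /= expr0 expr1 !(exprNn (1 + t)) !exprD; ring.
Qed.

(** Here two elements share the lowest level and [r] free elements follow. *)
Lemma lie_fun_cherry r : (r + 2 <= N)%N ->
  lie_fun (prefix_word 2 (multinom r)) =
  (-1) ^+ r * (2%:R * t * (1 + t) ^+ r - r%:R).
Proof.
move=> rN; rewrite (lie_fun_prefix (D := r)) //; try lia;
  try exact: zero_skipping_multinom; try exact: degree_le_multinom.
rewrite ideal_fun_multinom ?log_fun_multinom //; try lia.
by rewrite expr1 (exprNn (1 + t)); ring.
Qed.

End Functionals.
End Words.

(** * Coefficients of quasisymmetric functions *)

Section Coefficients.

Definition word_monomial (al : seq nat) : monomial :=
  [fsfun i in [fset i in iota 0 (size al)]%fset => nth 0%N al i | 0%N].

Lemma word_monomialE al i : word_monomial al i = nth 0%N al i.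
Proof.
rewrite fsfun_fun !inE mem_iota add0n /=; case: ltnP => // al_i.
by rewrite nth_default.
Qed.

Lemma exponents_word_monomial al : exponents (word_monomial al) = filter (ltn 0) al.
Proof.
rewrite /exponents; under eq_map do rewrite word_monomialE.
have -> : sort leq (finsupp (word_monomial al)) =
    filter (fun i => (0 < nth 0 al i)%N) (iota 0 (size al)).
  apply: (sorted_eq leq_trans anti_leq).
  - exact: sort_sorted leq_total _.
  - by apply: sorted_filter; [exact: leq_trans | exact: iota_sorted].
  - apply: uniq_perm; rewrite ?sort_uniq ?fset_uniq ?filter_uniq ?iota_uniq //.
    move=> i; rewrite mem_sort mem_finsupp word_monomialE mem_filter mem_iota add0n.
    rewrite -lt0n; case: (ltnP i) => [|al_i]; rewrite ?andbT //.
    by rewrite nth_default.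
have -> : filter (ltn 0) al = filter (ltn 0) (mkseq (nth 0%N al) (size al)).
  by rewrite mkseq_nth.
by rewrite /mkseq filter_map.
Qed.

(** Lists the factorizations of the monomial of [al] as pairs of words of the same length, so that
    the sum in [psmul] becomes one over a list. *)
Fixpoint splittings (al : seq nat) : seq (seq nat * seq nat) :=
  if al is b :: al' then
    [seq (c :: p.1, (b - c)%N :: p.2) | c <- iota 0 b.+1, p <- splittings al']
  else [:: ([::], [::])].

Lemma splittings_cons b al : splittings (b :: al) =
  [seq (c :: p.1, (b - c)%N :: p.2) | c <- iota 0 b.+1, p <- splittings al].
Proof. by []. Qed.

Lemma sum_splittings (R : comNzRingType) (A B : seq nat -> R) al :
  \sum_(p <- splittings al) A p.1 * B p.2 = qmul A B al.
Proof.
elim: al A B => [|b al IHal] A B; first by rewrite big_seq1.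
rewrite splittings_cons big_allpairs_dep [RHS]/=.
rewrite -(big_mkord xpredT (fun c => qmul (shift A c) (shift B (b - c)) al)).
by rewrite /index_iota subn0; apply: eq_bigr => c _; rewrite -IHal.
Qed.

Lemma splittings_uniq al : uniq (splittings al).
Proof.
elim: al => [//|b al IHal]; rewrite splittings_cons; apply: allpairs_uniq; rewrite ?iota_uniq //.
by move=> [c [u v]] [c' [u' v']] _ _ /= [-> -> _ ->].
Qed.

Lemma mem_splittings al (u v : seq nat) : (u, v) \in splittings al <->
  [/\ size u = size al, size v = size al &
      forall i, nth 0%N al i = (nth 0%N u i + nth 0%N v i)%N].
Proof.
elim: al u v => [|b al IHal] u v.
  rewrite inE; split=> [/eqP[-> ->]|[/size0nil-> /size0nil-> _]//].
  by split=> // i; rewrite !nth_nil.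
rewrite splittings_cons; split.
  move=> /allpairsP[[c [u' v']] [+ /IHal[su sv uv] [-> ->]]].
  rewrite mem_iota add0n ltnS /= su sv => cb.
  by split=> // -[|i] //=; rewrite subnKC.
case: u => [[]//|c u]; case: v => [[]//|d v] [[su] [sv] uv].
have /= bE := uv 0%N.
have mem_split := @flatten_mapP _ _ (fun c =>
  [seq (c :: p.1, (b - c)%N :: p.2) | p <- splittings al]) (iota 0 b.+1).
apply/mem_split; exists c; first by rewrite mem_iota add0n ltnS bE leq_addr.
apply/mapP; exists (u, v); last by rewrite /= bE addKn.
by apply/IHal; split=> // i; exact: (uv i.+1).
Qed.

Lemma psmul_word_monomial (f g : pseries) al :
  psmul f g (word_monomial al) =
  qmul (f \o word_monomial) (g \o word_monomial) al.
Proof.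
pose W (p : seq nat * seq nat) := (word_monomial p.1, word_monomial p.2).
have W_inj : {in splittings al &, injective W}.
  move=> [u v] [u' v'] /mem_splittings[su sv _] /mem_splittings[su' sv' _] [uu' vv'].
  congr pair; apply: (@eq_from_nth _ 0%N); rewrite ?su ?su' ?sv ?sv' // => i _.
    by rewrite -!word_monomialE uu'.
  by rewrite -!word_monomialE vv'.
rewrite -sum_splittings /psmul; transitivity (\sum_(p <- map W (splittings al)) f p.1 * g p.2).
  rewrite [RHS]fsbig_seq; last by rewrite map_inj_in_uniq // splittings_uniq.
  apply: eq_fsbigl; apply/seteqP; split=> [[m m'] /= mm'|[m m'] /= /mapP[[u v]]].
    apply/mapP; exists (mkseq m (size al), mkseq m' (size al)).
      apply/mem_splittings; rewrite !size_mkseq; split=> // i.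
      have := mm' i; rewrite word_monomialE => mm'i.
      have [i_al|al_i] := ltnP i (size al); first by rewrite !nth_mkseq.
      by rewrite !nth_default // size_mkseq.
    (* Beyond the length of [al] both factors have exponent zero, so the truncated words determine
       them. *)
    have mE k : (size al <= k)%N -> (m k = 0 /\ m' k = 0)%N.
      move=> alk; have := mm' k; rewrite word_monomialE nth_default //=.
      by move/esym/eqP; rewrite addn_eq0 => /andP[/eqP-> /eqP->].
    congr pair; apply/fsfunP => i; rewrite word_monomialE;
      (have [i_al|al_i] := ltnP i (size al); first by rewrite nth_mkseq);
      by rewrite nth_default ?size_mkseq //; case: (mE i al_i).
  move=> /mem_splittings[su sv uv] [-> ->] i.
  by rewrite !word_monomialE.
by rewrite big_map.
Qed.

(** Coefficients become constant polynomials because the linear form takes its values in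
    [{poly rat}]. *)
Definition word_coef (f : pseries) : seq nat -> {poly rat} :=
  fun al => (f (word_monomial al))%:P.

Lemma qmul_polyC (A B : seq nat -> rat) al :
  (qmul A B al)%:P = qmul (fun be => (A be)%:P) (fun be => (B be)%:P) al.
Proof.
elim: al A B => [|b al IHal] A B /=; first by rewrite polyCM.
by rewrite rmorph_sum; apply: eq_bigr => c _; rewrite /= IHal.
Qed.

Lemma word_coef_psmul (f g : pseries) : word_coef (psmul f g) = qmul (word_coef f) (word_coef g).
Proof. by apply/funext => al; rewrite /word_coef psmul_word_monomial qmul_polyC. Qed.

Lemma word_coefD (f g : QSym) : word_coef (f + g) = fun al => word_coef f al + word_coef g al.
Proof. by apply/funext => al; rewrite /word_coef -polyCD. Qed.

Lemma word_coef_sum (I : Type) (s : seq I) (P : pred I) (F : I -> QSym) al :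
  word_coef (\sum_(i <- s | P i) F i) al = \sum_(i <- s | P i) word_coef (F i) al.
Proof.
elim: s => [|i s IHs]; first by rewrite !big_nil.
by rewrite !big_cons; case: (P i) => //; rewrite word_coefD IHs.
Qed.

Lemma word_coef_quasisym (f : pseries) al be : f \in quasisym ->
  filter (ltn 0) al = filter (ltn 0) be -> word_coef f al = word_coef f be.
Proof.
by move=> /asboolP[_ fs] albe; congr _%:P; apply: fs; rewrite !exponents_word_monomial.
Qed.

Lemma zero_skipping_word_coef (f : QSym) : zero_skipping (word_coef f).
Proof.
move=> be al; apply: word_coef_quasisym; first exact: qvalP.
by rewrite !filter_cat.
Qed.

Lemma mdegree_word_monomial al : mdegree (word_monomial al) = sumn al.
Proof.
rewrite mdegreeE exponents_word_monomial.
by elim: al => [//|[|a] al IHal] //=; rewrite IHal.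
Qed.

Lemma degree_le_word_coef (f : QSym) : exists D, degree_le D (word_coef f).
Proof.
have /asboolP[[D fD] _] := qvalP f; exists D => al Dal.
rewrite /word_coef; have [-> //|/fD] := eqVneq (qval f (word_monomial al)) 0.
by rewrite mdegree_word_monomial leqNgt Dal.
Qed.

Lemma word_coef_inj (f g : QSym) :
  (forall al, all (ltn 0) al -> word_coef f al = word_coef g al) -> f = g.
Proof.
move=> fg; apply/val_inj/funext => m /=.
have /asboolP[_ fs] := qvalP f; have /asboolP[_ gs] := qvalP g.
have mE : exponents m = exponents (word_monomial (exponents m)).
  rewrite exponents_word_monomial; apply/esym/all_filterP/allP => i /mapP[j + ->].
  by rewrite mem_sort mem_finsupp /= lt0n.
rewrite (fs _ _ mE) (gs _ _ mE); apply: polyC_inj; apply: fg.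
rewrite -[exponents m]/(map _ _); apply/allP => i /mapP[j + ->].
by rewrite mem_sort mem_finsupp /= lt0n.
Qed.

Lemma word_coef_in_m (f : QSym) : in_m f -> word_coef f [::] = 0.
Proof.
move=> [k [g [gh ->]]]; rewrite word_coef_sum big1_seq // => d.
rewrite mem_index_iota => /andP[_ /andP[d0 _]]; rewrite /word_coef.
have [-> //|/gh] := eqVneq (qval (g d) (word_monomial [::])) 0.
by rewrite mdegree_word_monomial => d_eq; rewrite -d_eq in d0.
Qed.

(** Each product of two elements of [m] is killed by [lie_funM]. The threshold [N0] depends on the
    degrees of the chosen factors, hence on the way [f] is written as a sum of products. *)
Lemma lie_fun_m2 t (f : QSym) : f \in m2 ->
  exists N0, forall N, (N0 <= N)%N -> lie_fun N t (word_coef f) = 0.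
Proof.
move=> /asboolP[s [sm fE]].
have [N0 N0P] : exists N0, forall p, p \in s -> exists D D',
    [/\ degree_le D (word_coef p.1), degree_le D' (word_coef p.2) & (D + D' <= N0)%N].
  elim: s {sm fE} => [|p s [N0 IHs]]; first by exists 0%N.
  have [D pD] := degree_le_word_coef p.1; have [D' pD'] := degree_le_word_coef p.2.
  exists (D + D' + N0)%N => q; rewrite inE => /predU1P[->|/IHs[E [E' [qE qE' EN]]]].
    by exists D, D'; split=> //; lia.
  by exists E, E'; split=> //; lia.
exists N0 => N N0N.
have -> : word_coef f = fun al => \sum_(p <- s) qmul (word_coef p.1) (word_coef p.2) al.
  apply/funext => al; rewrite /word_coef fE -[LHS]/((_ : pseries) _)%:P.
  rewrite fct_sumE rmorph_sum; apply: eq_bigr => p _.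
  by rewrite -word_coef_psmul.
rewrite linear_fun_sum; last exact: linear_lie_fun.
rewrite big1_seq // => p /andP[_ ps]; have [D [D' [pD pD' DN]]] := N0P p ps.
have [p1m p2m] := sm p ps.
have DN' : (D + D' <= N)%N := leq_trans DN N0N.
rewrite (lie_funM t DN') //; try exact: zero_skipping_word_coef.
by rewrite !word_coef_in_m // mulr0 mul0r addr0.
Qed.

End Coefficients.

(** * Coefficients of fundamental quasisymmetric functions *)

Section Fundamental.

(** Finiteness turns the sum defining [fundamental] into an ordinary finite sum. *)
Lemma finite_compositions n : finite_set [set b | is_composition n b].
Proof.
pose f (b : n.-bseq 'I_n.+1) := map val b.
apply: (@sub_finite_set _ _ (f @` setT)); last exact/finite_image/finite_finset.
move=> b /= /andP[b_gt0 /eqP bn].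
have le_n : all (fun x => (x < n.+1)%N) b.
  rewrite -bn; elim: b {b_gt0 bn} => //= x b IHb.
  by rewrite ltnS leq_addr; apply: sub_all IHb => y; lia.
have size_n : (size b <= n)%N.
  by rewrite -bn; elim: b b_gt0 {bn le_n} => //= x b IHb /andP[x_gt0 /IHb]; lia.
pose b' := map (@inord n) b.
have b'n : (size b' <= n)%N by rewrite size_map.
exists (Bseq b'n) => //; rewrite /f /= -map_comp -[RHS]map_id.
by apply/eq_in_map => x /(allP le_n) xn /=; rewrite inordK.
Qed.

Lemma word_coef_fundamental a al : all (ltn 0) al ->
  word_coef (fundamental a) al = (is_composition (sumn a) al && refines al a)%:R.
Proof.
move=> al_gt0; rewrite /fundamental.
set C := [set b | _]; have Cfin : finite_set C.
  by apply: sub_finite_set (finite_compositions (sumn a)) => b [].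
rewrite fsbig_finite // word_coef_sum.
have E b : word_coef (Mon b) al = (al == b)%:R.
  rewrite /word_coef /= /monomial_series exponents_word_monomial.
  by rewrite (all_filterP al_gt0) polyC_natr.
under eq_bigr => b _ do rewrite E.
have -> : is_composition (sumn a) al && refines al a = (al \in fset_set C).
  by rewrite in_fset_set //; apply/andP/idP => [[]|]; rewrite inE.
have [alC|alC] := boolP (al \in fset_set C).
  rewrite (big_fsetD1 al) //= eqxx big1_fset ?addr0 // => b.
  by rewrite !inE eq_sym => /andP[/negPf-> _].
rewrite big1_fset // => b bC _; case: eqP => // al_b.
by rewrite al_b bC in alC.
Qed.

Definition partial_sums al := [seq sumn (take i al) | i <- iota 1 (size al)].

Lemma partial_sums_cons c al :
  partial_sums (c :: al) = c :: map (addn c) (partial_sums al).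
Proof.
by rewrite /partial_sums /= take0 addn0 (iotaDl 1 1) -!map_comp; congr (_ :: _).
Qed.

Lemma proper_partial_sums_cons c d al :
  proper_partial_sums (c :: d :: al) = c :: map (addn c) (proper_partial_sums (d :: al)).
Proof.
rewrite /proper_partial_sums [iota _ _]/= [map _ (_ :: _)]/= addn0; congr (_ :: _).
by rewrite (iotaDl 1 1) -!map_comp; apply/eq_in_map => i.
Qed.

Lemma partial_sums_rcons c al :
  partial_sums (c :: al) = rcons (proper_partial_sums (c :: al)) (sumn (c :: al)).
Proof.
rewrite /partial_sums /proper_partial_sums [size _]/= -cats1.
by rewrite -[X in iota _ X]addn1 iotaD map_cat /= take_size.
Qed.

Lemma mem_proper_partial_sums al i : (i < sumn al)%N ->
  (i \in proper_partial_sums al) = (i \in partial_sums al).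
Proof.
case: al => // c al lt_i; rewrite partial_sums_rcons mem_rcons inE.
by have [ieq|] := eqVneq; first by rewrite ieq ltnn in lt_i.
Qed.

Definition descents (s : seq nat) :=
  [seq i <- iota 1 (size s).-1 | ~~ (nth 0 s i.-1 < nth 0 s i)%N].

Lemma mem_descents s i : (i \in descents s) =
  [&& (0 < i)%N, (i < size s)%N & ~~ (nth 0 s i.-1 < nth 0 s i)%N].
Proof.
rewrite mem_filter mem_iota andbC andbA; congr (_ && _).
by case: s => [|x s] /=; lia.
Qed.

Lemma sumn_run_composition s : sumn (run_composition s) = size s.
Proof.
elim: s => [//|x [|y s] //= IHs]; case: ifP => _; last by rewrite /= IHs.
by case: (if s is _ :: _ then _ else _) IHs => //= r rs <-.
Qed.

Lemma proper_partial_sums_run s :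
  proper_partial_sums (run_composition s) = descents s.
Proof.
elim: s => [//|x [|y s] // IHs].
have -> : descents (x :: y :: s) =
    (if (x < y)%N then [::] else [:: 1%N]) ++ map (addn 1) (descents (y :: s)).
  rewrite /descents [(size _).-1]/= [(size _).-1]/= -[(size s).+1]add1n iotaD filter_cat.
  congr (_ ++ _); first by rewrite /=; case: ltnP.
  rewrite iotaDl filter_map; congr map; apply: eq_in_filter => -[|i]; last by [].
  by rewrite mem_iota.
rewrite -{}IHs [run_composition (x :: y :: s)]/= -/(run_composition (y :: s)).
have : sumn (run_composition (y :: s)) = (size s).+1 by rewrite sumn_run_composition.
case: (run_composition (y :: s)) => [//|r rs] _.
case: ifP => _; last by rewrite proper_partial_sums_cons.
rewrite /proper_partial_sums [size _]/= [size _]/= -map_comp.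
apply/eq_in_map => -[|i] /=; first by rewrite mem_iota.
by [].
Qed.

(** Refinement of the run composition, read directly on the word cut into blocks of lengths [al]. *)
Fixpoint blocks_increasing (al s : seq nat) : bool :=
  if al is c :: al' then
    [&& (c <= size s)%N, sorted ltn (take c s) & blocks_increasing al' (drop c s)]
  else s == [::].

Lemma sumn_blocks al s : blocks_increasing al s -> sumn al = size s.
Proof.
elim: al s => [|c al IHal] s /=; first by move/eqP->.
by case/and3P => cs _ /IHal->; rewrite size_drop subnKC.
Qed.

(** By induction on the blocks: a descent falls inside the first block, at its end, or is a descent
    of the remaining word moved by [c]. *)
Lemma blocks_increasingP al s : sumn al = size s ->
  reflect (forall i, i \in descents s -> i \in partial_sums al)
          (blocks_increasing al s).
Proof.
elim: al s => [|c al IHal] s als.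
  by case: s als => // _; apply: ReflectT.
have cs : (c <= size s)%N by rewrite -als leq_addr.
have als' : sumn al = size (drop c s) by rewrite size_drop -als addKn.
rewrite /= cs /=.
have descE' i : (i \in descents (drop c s)) =
    [&& (0 < i)%N, (i < size s - c)%N & ~~ (nth 0 s (c + i).-1 < nth 0 s (c + i))%N].
  by rewrite mem_descents size_drop; case: i => // i; rewrite !nth_drop addnS.
have sortP : reflect (forall i, (i.+1 < c)%N -> (nth 0 s i < nth 0 s i.+1)%N)
    (sorted ltn (take c s)).
  apply: (iffP (sortedP 0%N)) => [H i ic|H i].
    by have := H i; rewrite size_takel // => /(_ ic);
      rewrite (nth_take _ ic) (nth_take _ (ltnW ic)).
  by rewrite size_takel // => ic; rewrite (nth_take _ ic) (nth_take _ (ltnW ic)); exact: H.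
apply: (iffP andP) => [[/sortP sorted_c /(IHal _ als') IH] i|H].
  rewrite mem_descents partial_sums_cons inE => /and3P[i0 i_s ides].
  have [ic|ci|->] := ltngtP i c.
  - by case: i i0 ic ides {i_s} => // i _ ic; rewrite /= sorted_c.
  - apply/mapP; exists (i - c)%N; last by rewrite subnKC // ltnW.
    by apply: IH; rewrite descE' subnKC ?ides //; lia.
  - by [].
have ge_c i : i \in partial_sums (c :: al) -> (c <= i)%N.
  by rewrite partial_sums_cons inE => /predU1P[->//|/mapP[j _ ->]]; lia.
split; [apply/sortP => i ic; apply/negPn/negP => ides | apply/(IHal _ als') => i].
  have := ge_c i.+1 (H _ _); rewrite mem_descents /= ides (leq_trans ic cs) => /(_ isT).
  by lia.
rewrite descE' => /and3P[i0 i_s ides].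
have := H (c + i)%N; rewrite mem_descents ides partial_sums_cons inE.
have -> : (0 < c + i)%N && ((c + i < size s)%N && true) by lia.
case/(_ isT)/predU1P => [|/mapP[j jal]]; first by lia.
by move/addnI->.
Qed.

Lemma refines_run_composition al s : all (ltn 0) al ->
  is_composition (sumn (run_composition s)) al && refines al (run_composition s) =
  blocks_increasing al s.
Proof.
move=> al_gt0; rewrite /is_composition al_gt0 /= /refines sumn_run_composition andbA andbb.
have [als|als] := eqVneq (sumn al) (size s) => /=; last first.
  by apply/esym/negbTE; apply: contra als => /sumn_blocks->.
rewrite proper_partial_sums_run; apply/idP/(blocks_increasingP als).
  move=> /allP H i ides; rewrite -mem_proper_partial_sums; first exact: (H i ides).
  by move: ides; rewrite als mem_descents => /and3P[].
move=> H; apply/allP => i ides /=; rewrite mem_proper_partial_sums ?H //.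
by move: ides; rewrite als mem_descents => /and3P[].
Qed.

End Fundamental.

(** * Linear extensions and colourings *)

Section Posets.
Variables (E : finType) (lt : rel E).
Implicit Types (U I : {set E}) (s : seq E).

Definition bottom_level U c I :=
  [&& I \subset U, #|I| == c & [forall x in I, forall y in U, ~~ lt y x]].

(* The number of strict order-preserving colourings of [U] whose successive
   colour classes have the cardinalities listed in [al]. *)
Fixpoint colourings U (al : seq nat) : nat :=
  if al is c :: al' then
    (\sum_(I | bottom_level U c I) colourings (U :\: I) al')%N
  else (U == finset.set0).

Variable w : E -> nat.
Hypotheses (w_inj : injective w) (w_lt : forall x y, lt x y -> (w y < w x)%N).

Definition listing I := sort (relpre w leq) (enum I).

Lemma mem_listing I : listing I =i I.
Proof. by move=> x; rewrite mem_sort mem_enum. Qed.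

Lemma listing_uniq I : uniq (listing I).
Proof. by rewrite sort_uniq enum_uniq. Qed.

Lemma size_listing I : size (listing I) = #|I|.
Proof. by rewrite size_sort cardE. Qed.

Lemma sorted_listing I : sorted ltn (map w (listing I)).
Proof.
rewrite ltn_sorted_uniq_leq (map_inj_uniq w_inj) listing_uniq /= sorted_map.
by apply: sort_sorted => x y; exact: leq_total.
Qed.

Lemma listing_set s : uniq s -> sorted ltn (map w s) ->
  listing [set x in s]%SET = s.
Proof.
move=> s_uniq s_sorted; apply: (@sorted_eq _ (relpre w leq)).
- by move=> y x z; exact: leq_trans.
- by move=> x y /anti_leq/w_inj.
- by rewrite -sorted_map; have := sorted_listing [set x in s]%SET;
    rewrite ltn_sorted_uniq_leq => /andP[].
- by rewrite -sorted_map; move: s_sorted; rewrite ltn_sorted_uniq_leq => /andP[].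
- apply: uniq_perm; rewrite ?listing_uniq // => x.
  by rewrite mem_listing inE.
Qed.

(** The linear extensions of [U] that contribute to the coefficient at [al]. *)
Definition compatible U (al : seq nat) s :=
  [/\ uniq s, s =i U,
      {in U &, forall x y, lt x y -> (index x s < index y s)%N} &
      blocks_increasing al (map w s)].

(** Each colouring gives one word: its colour classes in turn, each listed by increasing label. *)
Fixpoint compatible_words U (al : seq nat) : seq (seq E) :=
  if al is c :: al' then
    [seq listing J ++ s | J <- enum (bottom_level U c),
                          s <- compatible_words (U :\: J) al']
  else if U == finset.set0 then [:: [::]] else [::].

Lemma size_compatible_words U al : size (compatible_words U al) = colourings U al.
Proof.
elim: al U => [|c al IHal] U /=; first by case: eqP.
rewrite size_allpairs_dep sumnE big_map -big_enum.
by apply: eq_bigr => I _; rewrite IHal.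
Qed.

Lemma compatible_cons U c al s : compatible U (c :: al) s <->
  exists I s', [/\ bottom_level U c I, compatible (U :\: I) al s' &
                   s = listing I ++ s'].
Proof.
split.
  case=> s_uniq sU s_lt /= /and3P[]; rewrite size_map -map_take -map_drop => cs.
  move=> s_sorted s_blocks.
  have tu : uniq (take c s) by rewrite take_uniq.
  have := s_uniq; rewrite -{1}(cat_take_drop c s) cat_uniq => /and3P[_ /hasPn td du].
  exists [set x in take c s]%SET, (drop c s).
  have idx x : x \in take c s -> index x s = index x (take c s).
    by move=> xc; rewrite -{1}(cat_take_drop c s) index_cat xc.
  split; last by rewrite listing_set // cat_take_drop.
    apply/and3P; split.
    - by apply/fintype.subsetP => x; rewrite inE -sU => /mem_take.
    - by rewrite cardsE (card_uniqP tu) size_takel.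
    - apply/forall_inP => x; rewrite inE => xc; apply/forall_inP => y yU.
      (* An element [y] below [x] precedes it in [s], so it lies in the same first block. Labels
         increase along the block but decrease along the order. *)
      apply/negP => lt_yx; have xU : x \in U by rewrite -sU (mem_take xc).
      have := s_lt y x yU xU lt_yx; rewrite (idx x xc) => yx.
      have yc : y \in take c s.
        have xlt : (index x (take c s) < c)%N.
          by rewrite -[X in (_ < X)%N](size_takel cs) index_mem.
        have ylt := ltn_trans yx xlt.
        rewrite -(nth_index y (_ : y \in s)) ?sU // -(nth_take y ylt).
        by rewrite mem_nth // size_takel.
      rewrite (idx y yc) in yx.
      have := sorted_ltn_nth ltn_trans 0%N s_sorted.
      move/(_ (index y (take c s)) (index x (take c s))).
      rewrite !inE !size_map !index_mem => /(_ yc xc yx).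
      rewrite !(nth_map y) ?index_mem // !nth_index // => wyx.
      by have := ltn_trans wyx (w_lt lt_yx); rewrite ltnn.
  split=> //.
  - move=> x; rewrite !inE -sU -{3}(cat_take_drop c s) mem_cat.
    have [/td/negPf-> //|xd] := boolP (x \in drop c s).
    by rewrite orbF; case: (x \in take c s).
  - move=> x y; rewrite !inE => /andP[xc xU] /andP[yc yU] lt_xy.
    have := s_lt x y xU yU lt_xy.
    by rewrite -(cat_take_drop c s) !index_cat (negPf xc) (negPf yc) ltn_add2l cat_take_drop.
case=> I [s' [/and3P[IU /eqP cardI /forall_inP Imin] [s'_uniq s'U s'_lt s'_blocks] ->]].
split.
- rewrite cat_uniq listing_uniq s'_uniq andbT /=; apply/hasPn => x.
  by rewrite s'U mem_listing inE => /andP[].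
- move=> x; rewrite mem_cat mem_listing s'U inE.
  by have [/(fintype.subsetP IU)|] := boolP (x \in I).
- move=> x y xU yU lt_xy; rewrite !index_cat !mem_listing.
  have [yI|yI] := boolP (y \in I).
    by have /forall_inP/(_ x xU) := Imin y yI; rewrite lt_xy.
  have [xI|xI] := boolP (x \in I).
    by rewrite (leq_trans _ (leq_addr _ _)) // index_mem mem_listing.
  by rewrite ltn_add2l; apply: s'_lt; rewrite // inE ?xI ?yI.
- rewrite /= map_cat size_cat size_map size_listing cardI leq_addr.
  have sI : size (map w (listing I)) = c by rewrite size_map size_listing.
  by rewrite -{1 2}sI take_size_cat // drop_size_cat // sorted_listing.
Qed.

Lemma mem_compatible_words U al s :
  s \in compatible_words U al <-> compatible U al s.
Proof.
elim: al U s => [|c al IHal] U s.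
  rewrite /=; case: eqP => [->|U0]; rewrite inE; split=> //.
  - by move=> /eqP->; split=> // x; rewrite !inE.
  - by case=> _ _ _; case: s.
  - case=> _ sU _; case: s sU => [|x s] sU //= _; case: U0; apply/setP => x.
    by rewrite -sU !inE.
rewrite compatible_cons; split.
  move=> /allpairsPdep[I [s' [+ /IHal s'_good ->]]].
  by rewrite mem_enum => UI; exists I, s'.
case=> J [s' [UI /IHal s'_good ->]].
apply/allpairsPdep; exists J, s'; split=> //.
by rewrite mem_enum.
Qed.

Lemma compatible_words_uniq U al : uniq (compatible_words U al).
Proof.
elim: al U => [|c al IHal] U /=; first by case: ifP.
apply: allpairs_uniq_dep; rewrite ?enum_uniq // => -[I s] [I' s'].
move=> /allpairsPdep[J [t [+ _ [-> ->]]]] /allpairsPdep[J' [t' [+ _ [-> ->]]]] /=.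
rewrite !mem_enum => /and3P[_ /eqP cJ _] /and3P[_ /eqP cJ' _] JJ'.
have sJ : size (listing J) = size (listing J') by rewrite !size_listing cJ cJ'.
move/eqP: JJ'; rewrite eqseq_cat // => /andP[/eqP JJ' /eqP->].
suff -> : J = J' by [].
by apply/setP => x; rewrite -mem_listing JJ' mem_listing.
Qed.

(* The fundamental theorem of P-partitions, for a strict labeling. *)
Lemma word_coef_poset_qsym al : all (ltn 0) al ->
  word_coef (poset_qsym lt w) al = (colourings [set: E]%SET al)%:R.
Proof.
move=> al_gt0; rewrite /poset_qsym word_coef_sum.
under eq_bigr => s _ do
  rewrite word_coef_fundamental // refines_run_composition //.
rewrite -natr_sum -big_mkcondr /= sum1_card -size_compatible_words.
congr _%:R; rewrite cardE -(size_map val); apply: perm_size; apply: uniq_perm.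
- by rewrite map_inj_uniq ?enum_uniq //; exact: val_inj.
- exact: compatible_words_uniq.
move=> s; apply/mapP/idP => [[t + ->]|/mem_compatible_words[s_uniq sE s_lt s_blocks]].
  rewrite mem_enum => /andP[/asboolP[t_uniq tE t_lt] t_blocks].
  apply/mem_compatible_words; split=> // x; first by rewrite tE inE.
  by move=> y _ _; exact: t_lt.
have sizes : size s == #|E|.
  by rewrite -(card_uniqP s_uniq) (eq_card sE) cardsT.
exists (Tuple sizes) => //; rewrite mem_enum; apply/andP; split=> //.
apply/asboolP; split=> // [x|x y]; first by rewrite sE inE.
by move=> lt_xy; apply: s_lt; rewrite ?inE.
Qed.

End Posets.

(** * Colourings of antichains and of stars with isolated points *)

Section Colourings.
Variables (R : comNzRingType) (E : finType) (lt : rel E).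
Implicit Types (U P Q : {set E}) (al : seq nat).

(** Every [c]-element subset can be the lowest level, which gives one binomial coefficient per
    letter. *)
Lemma colourings_antichain U al : {in U &, forall x y, ~~ lt x y} ->
  (colourings lt U al)%:R = multinom R #|U| al.
Proof.
elim: al U => [|c al IHal] U U_anti /=; first by rewrite cards_eq0.
rewrite natr_sum (eq_bigl [in [set J : {set E} | J \subset U & #|J| == c]%SET]).
  rewrite (eq_bigr (fun=> multinom R (#|U| - c) al)).
    by rewrite sumr_const cards_draws mulr_natl.
  move=> J; rewrite inE => /andP[JU /eqP Jc].
  rewrite IHal ?cardsDS ?Jc // => x y; rewrite !inE => /andP[_ xU] /andP[_ yU].
  exact: U_anti.
move=> J; rewrite !inE /bottom_level; case: (boolP (J \subset U)) => //= JU.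
case: (_ == _) => //=; apply/forall_inP => x xJ; apply/forall_inP => y yU.
by apply: U_anti => //; exact: (fintype.subsetP JU).
Qed.

(** [U] is the disjoint union of isolated points [P] and a star with minimum [b] and leaves [Q], so
    its enumerator is a product. *)
Lemma colourings_star U b P Q al :
  b \in U -> P = (U :\ b :\: Q)%SET -> Q \subset (U :\ b)%SET ->
  {in U &, forall x y, lt x y = (x == b) && (y \in Q)} ->
  (colourings lt U al)%:R =
  qmul (multinom R #|P|) (prefix_word 1 (multinom R #|Q|)) al.
Proof.
elim: al U P => [|c al IHal] U P bU PE QU U_lt /=.
  by rewrite mulr0; case: eqP => // U0; rewrite U0 inE in bU.
have bQ : b \notin Q by apply/negP => /(fintype.subsetP QU); rewrite !inE eqxx.
have bP : b \notin P by rewrite PE !inE eqxx andbF.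
have PU : P \subset U by apply/fintype.subsetP => x; rewrite PE !inE => /and3P[].
have cardU : #|U| = (#|P| + #|Q|).+1.
  by rewrite (cardsD1 b) bU PE (cardsDS QU) subnK // subset_leq_card.
have bottomE J : bottom_level lt U c J = [&& J \subset (b |: P)%SET & #|J| == c].
  rewrite /bottom_level; apply/and3P/andP => [[JU -> J_min]|[JP ->]]; split=> //.
  - apply/fintype.subsetP => x xJ; have xU := fintype.subsetP JU x xJ.
    rewrite PE !inE xU andbT; case: eqP => //= _.
    have /forall_inP/(_ b bU) := forall_inP J_min x xJ.
    by rewrite U_lt // eqxx andbT.
  - by apply: (fintype.subset_trans JP); rewrite finset.subUset finset.sub1set bU.
  - apply/forall_inP => x /(fintype.subsetP JP) xP; apply/forall_inP => y yU.
    have xU : x \in U by case/finset.setU1P: xP => [->//|]; exact: (fintype.subsetP PU).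
    rewrite U_lt // negb_and; case/finset.setU1P: xP => [->|]; first by rewrite bQ orbT.
    by rewrite PE !inE => /andP[-> _]; rewrite orbT.
rewrite natr_sum (bigID (fun J : {set E} => b \in J)) /=.
(* When [b] is not in the lowest level, that level is a subset of [P] and a smaller poset of the
   same shape remains. *)
have free_part : \sum_(J | bottom_level lt U c J && (b \notin J))
    (colourings lt (U :\: J) al)%:R = 'C(#|P|, c)%:R * qmul (multinom R (#|P| - c)) (prefix_word 1 (multinom R #|Q|)) al.
  rewrite (eq_bigl [in [set J : {set E} | J \subset P & #|J| == c]%SET]).
    rewrite -cards_draws mulr_natl -sumr_const; apply: eq_bigr => J.
    rewrite inE => /andP[JP /eqP <-].
    rewrite (IHal (U :\: J) (P :\: J)) ?cardsDS //.
    - by rewrite inE bU andbT; apply: contra bP; exact: (fintype.subsetP JP).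
    - apply/setP => x; rewrite PE !inE; case: (x == b); rewrite ?andbF //=.
      by case: (x \in J); rewrite ?andbF.
    - apply/fintype.subsetP => x xQ; have := fintype.subsetP QU x xQ.
      rewrite !inE => /andP[-> ->]; rewrite andbT /=; apply/negP => /(fintype.subsetP JP).
      by rewrite PE inE xQ.
    - by move=> x y; rewrite !inE => /andP[_ xU] /andP[_ yU]; exact: U_lt.
  move=> J; rewrite bottomE !inE; apply/andP/andP => [[/andP[JP ->] bJ]|[JP ->]]; split=> //.
  - apply/fintype.subsetP => x xJ; have /finset.setU1P[xb|//] := fintype.subsetP JP x xJ.
    by rewrite xb (negPf bJ) in xJ.
  - by rewrite andbT; apply: (fintype.subset_trans JP); exact: finset.subsetUr.
  - by apply: contra bP; exact: (fintype.subsetP JP).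
(* When [b] is in the lowest level, an antichain remains. *)
have top_part : \sum_(J | bottom_level lt U c J && (b \in J))
    (colourings lt (U :\: J) al)%:R = if c is c'.+1 then 'C(#|P|, c')%:R * multinom R (#|P| - c' + #|Q|) al else 0.
  case: c bottomE {free_part} => [|c] bottomE.
    rewrite big_pred0 // => J; rewrite bottomE cards_eq0.
    by case: eqP => [->|_]; rewrite ?inE ?andbF.
  have addb_inj : {in [set J : {set E} | J \subset P & #|J| == c]%SET &,
      injective (fun J => b |: J)%SET}.
    move=> J J'; rewrite !inE => /andP[JP _] /andP[J'P _] /(congr1 (fun K => K :\ b)%SET).
    by rewrite !finset.setU1K //; apply: contra bP; exact: (fintype.subsetP _).
  rewrite (eq_bigl [in [set (b |: J)%SET | J in
    [set J : {set E} | J \subset P & #|J| == c]%SET]%SET]).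
    rewrite -cards_draws mulr_natl -sumr_const big_imset //=; apply: eq_bigr => J.
    rewrite inE => /andP[JP /eqP Jc]; rewrite colourings_antichain.
      rewrite cardsDS ?cardU ?finset.subUset ?finset.sub1set ?bU ?(fintype.subset_trans JP) //.
      have bJ : b \notin J by apply: contra bP; exact: (fintype.subsetP JP).
      rewrite cardsU1 bJ Jc; have := subset_leq_card JP; rewrite Jc => cP.
      by congr (multinom _ _ _); lia.
    move=> x y; rewrite !inE negb_or => /andP[/andP[xb _] xU] /andP[_ yU].
    by rewrite U_lt // (negPf xb).
  move=> J; rewrite bottomE; apply/andP/imsetP => [[/andP[JP Jc] bJ]|[K]].
    exists (J :\ b)%SET; last by rewrite finset.setD1K.
    rewrite inE; move: Jc; rewrite (cardsD1 b) bJ eqSS => ->; rewrite andbT.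
    apply/fintype.subsetP => x; rewrite !inE => /andP[xb /(fintype.subsetP JP)].
    by rewrite !inE (negPf xb).
  rewrite inE => /andP[KP /eqP Kc] ->; rewrite finset.setUS //= finset.setU11; split=> //.
  have bK : b \notin K by apply: contra bP; exact: (fintype.subsetP KP).
  by rewrite cardsU1 bK Kc.
(* A factor [prefix_word 1] has nonzero shifts only at 0 and 1: these are the last two terms of the
   sum in [qmul], matching the two parts. *)
rewrite free_part top_part addrC big_ord_recr /= subnn addrC.
rewrite shift_prefix_word0 shift_multinom qmulZl; congr (_ + _).
case: c {bottomE free_part top_part} => [|c]; first by rewrite big_ord0.
rewrite big_ord_recr /= subSnn shift_prefix_word // shift_multinom qmulZl qmul_multinom.
rewrite big1 ?add0r // => d _.
rewrite [shift (prefix_word _ _) _]shift_prefix_word_neq ?qmul0r //;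
  by have := ltn_ord d; lia.
Qed.

End Colourings.

(** * Rank two matroids *)

Section RankTwo.
Variables (E : finType) (M : matroid E) (la : seq nat).
Hypothesis rank2 : is_rank_two_matroid M la.
Implicit Types (B : {set E}) (a b : E).

(** Exchanging an element of [B'] against [B] would require an element of [B] outside [B']. *)
Lemma bases_eq_sub B B' : B \in bases M -> B' \in bases M -> B \subset B' -> B = B'.
Proof.
move=> BM B'M BB'; apply/eqP; rewrite finset.eqEsubset BB' /=; apply/fintype.subsetP => x xB'.
apply/negPn/negP => xB; have xD : x \in B' :\: B by rewrite inE xB.
have [y] := bases_exchange B'M BM xD.
by rewrite inE => /andP[/negP yB' yB]; case: yB'; exact: (fintype.subsetP BB').
Qed.

(** [rank] is a maximum, so equality of cardinalities comes from exchange: a smaller basis would be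
    properly contained in a basis with two elements. *)
Lemma card_base B : B \in bases M -> #|B| = 2%N.
Proof.
case: rank2 => _ r2 _ BM.
have le2 : (#|B| <= 2)%N by rewrite -r2; apply: (leq_bigmax_cond (F := fun B : {set E} => #|B|)).
have [B' B'M B'2] : exists2 B', B' \in bases M & #|B'| = 2%N.
  have M0 : (0 < #|bases M|)%N by apply/card_gt0P; exists B.
  have [B' B'M B'2] := eq_bigmax_cond (fun B : {set E} => #|B|) M0.
  by exists B' => //; rewrite -B'2.
apply/eqP; rewrite eqn_leq le2 /= ltnNge; apply/negP => B1.
have [/cards0_eq B0|] := posnP #|B|.
  have := bases_eq_sub BM B'M; rewrite B0 finset.sub0set => /(_ isT) B'0.
  by rewrite -B'0 cards0 in B'2.
move=> B_gt0; have /eqP/cards1P[b Bb] : #|B| = 1%N by lia.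
have [bB'|bB'] := boolP (b \in B').
  have := bases_eq_sub BM B'M; rewrite Bb finset.sub1set => /(_ bB') BB'.
  by rewrite -BB' cards1 in B'2.
have [x xB'] : exists x, x \in B' by apply/finset.set0Pn; rewrite -card_gt0 B'2.
(* Since [B] is the singleton of [b], exchanging [x] can only bring in [b], and yields a two-element
   basis containing [B]. *)
have xD : x \in B' :\: B by rewrite inE xB' andbT Bb inE; apply: contraNneq bB' => <-.
have [y] := bases_exchange B'M BM xD.
rewrite Bb !inE => /andP[_ /eqP->] CM.
have := bases_eq_sub BM CM; rewrite Bb finset.sub1set finset.setU11 => /(_ isT).
move/(congr1 (fun C : {set E} => #|C|)); rewrite cards1 cardsU1 !inE (negPf bB') andbF /=.
by have := cardsD1 x B'; rewrite xB' B'2; lia.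
Qed.

Lemma base_pair a b : ([set a; b]%SET \in bases M) = ~~ parallel M a b.
Proof.
rewrite /parallel negb_or negbK /independent.
apply/idP/andP => [abM|[ab /exists_inP[B BM abB]]].
  split; last by apply/exists_inP; exists [set a; b]%SET.
  by have := card_base abM; rewrite cards2; case: eqP.
suff -> : [set a; b]%SET = B by [].
by apply/eqP; rewrite eqEcard abB (card_base BM) cards2 ab.
Qed.

Lemma parallel_refl a : parallel M a a.
Proof. by rewrite /parallel eqxx. Qed.

Lemma parallel_sym a b : parallel M a b = parallel M b a.
Proof. by apply: negb_inj; rewrite -!base_pair finset.setUC. Qed.

(** As [b] is no loop, it lies in a basis with some [d]. If [a] and [c] formed a basis, exchanging
    [d] would make [b] independent of [a] or of [c]; so it already is if [d] is [a] or [c]. *)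
Lemma parallel_trans a b c : parallel M a b -> parallel M b c -> parallel M a c.
Proof.
move=> ab bc; apply/negPn/negP; rewrite -base_pair => acM.
case: rank2 => /(_ b) + _ _; rewrite /loop negbK => /exists_inP[B BM].
rewrite finset.sub1set => bB.
have [d Bd] : exists d, B = [set b; d]%SET.
  have : #|B :\ b| = 1%N by have := cardsD1 b B; rewrite bB (card_base BM); lia.
  by move/eqP/cards1P => [d Bd]; exists d; rewrite -(finset.setD1K bB) Bd.
have baM : [set b; a]%SET \notin bases M by rewrite base_pair parallel_sym ab.
have bcM : [set b; c]%SET \notin bases M by rewrite base_pair bc.
have [dac|dac] := boolP (d \in [set a; c]%SET).
  by move: dac; rewrite !inE => /orP[] /eqP dE; move: BM;
    rewrite Bd dE ?(negPf baM) ?(negPf bcM).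
have dD : d \in B :\: [set a; c]%SET by rewrite inE dac Bd !inE eqxx orbT.
have [x] := bases_exchange BM acM dD.
have bd : b != d.
  by have := card_base BM; rewrite Bd cards2; case: eqP.
have -> : (B :\ d = [set b])%SET.
  apply/setP => y; rewrite Bd !inE.
  by case: (eqVneq y d) => [->|]; rewrite ?orbF //= eq_sym (negPf bd).
rewrite (finset.setUC [set x]%SET) !inE => /andP[_ /orP[] /eqP->];
  by rewrite ?(negPf baM) ?(negPf bcM).
Qed.

Definition parallel_class a := [set b | parallel M a b]%SET.

(** A class of size [s] is met once for each of its [s] elements. *)
Lemma parallel_class_sum (V : nmodType) (g : nat -> V) :
  \sum_a g #|parallel_class a| = \sum_(s <- la) g s *+ s.
Proof.
have eqv : {in [set: E]%SET & &, equivalence_rel (parallel M)}.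
  move=> x y z _ _ _; split; first exact: parallel_refl.
  move=> xy; apply/idP/idP; last exact: parallel_trans.
  by apply: parallel_trans; rewrite parallel_sym.
case: rank2 => no_loop _ la_perm.
have nlE : [set e | ~~ loop M e]%SET = [set: E]%SET.
  by apply/setP => x; rewrite !inE no_loop.
have partE := equivalence_partitionP eqv.
transitivity (\sum_(C in parallel_classes M) g #|C| *+ #|C|).
  rewrite /parallel_classes nlE (eq_bigl [in [set: E]%SET]); last first.
    by move=> x; rewrite inE.
  rewrite (set_partition_big _ partE) /=; apply: eq_bigr => C CP.
  rewrite -sumr_const; apply: eq_bigr => x xC; congr (g #|pred_of_set _|).
  case/and3P: partE => _ trivP _; rewrite -(def_pblock trivP CP xC).
  by apply/setP => y; rewrite inE (pblock_equivalence_partition eqv) ?inE.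
by rewrite -(perm_big _ la_perm) big_map big_enum.
Qed.

Lemma sumn_rank2 : sumn la = #|E|.
Proof.
have := parallel_class_sum (fun=> 1%N); rewrite sum_nat_const muln1 sumnE => ->.
by apply: eq_bigr => s _; elim: s => // s IHs; rewrite mulrS -IHs.
Qed.

Lemma parallel_class_refl a : a \in parallel_class a.
Proof. by rewrite inE parallel_refl. Qed.

Lemma base_unordered B : B \in bases M ->
  exists a b, [/\ a != b, B = [set a; b]%SET & ~~ parallel M a b].
Proof.
move=> BM; have /eqP/cards2P[a [b [ab BE]]] := card_base BM.
by exists a, b; split=> //; rewrite -base_pair -BE.
Qed.

(** * Colourings of the posets attached to bases *)

Section Labeled.
Variable R : comNzRingType.

(* With [s] the size of the class of [a]: the colourings of [P_B] in which the
   element [a] of the basis [B] comes first, alone in its level. *)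
Definition first_level n s : seq nat -> R :=
  prefix_word 1 (qmul (multinom R s.-1) (prefix_word 1 (multinom R (n - s).-1))).

(** Replacing [a] by [y] leaves a basis exactly when [y] is not parallel to [b], and
    symmetrically. *)
Lemma basis_lt_pair a b x y : ~~ parallel M a b ->
  basis_lt M [set a; b]%SET x y =
  ((x == a) && (y \notin a |: parallel_class b)%SET) ||
  ((x == b) && (y \notin b |: parallel_class a)%SET).
Proof.
move=> ab; have a_b : a != b by apply: contraNneq ab => ->; exact: parallel_refl.
rewrite /basis_lt /= !inE.
have [->|xa] := eqVneq x a; rewrite /= ?(negPf a_b) ?orbF.
  have -> : ([set a; b] :\ a = [set b])%SET.
    by apply/setP => z; rewrite !inE; case: eqVneq => //= ->; rewrite (negPf a_b).
  rewrite base_pair parallel_sym; case: (eqVneq y a) => //= _.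
  by case: (eqVneq y b) => [->|_] //=; rewrite parallel_refl.
have [->|//] := eqVneq x b; rewrite /=.
have -> : ([set a; b] :\ b = [set a])%SET.
  apply/setP => z; rewrite !inE.
  by case: (eqVneq z b) => [->|]; rewrite ?orbF //= eq_sym (negPf a_b).
rewrite base_pair parallel_sym.
case: (eqVneq y b) => _; rewrite ?orbT //= ?orbF.
by case: (eqVneq y a) => [->|_] //=; rewrite parallel_refl.
Qed.

(** Once [a] is removed, [b] lies below all other elements not parallel to [a], and the rest of the
    class of [a] is isolated. *)
Lemma colourings_without a b al : ~~ parallel M a b ->
  (colourings (basis_lt M [set a; b]%SET) ([set: E] :\ a)%SET al)%:R =
  qmul (multinom R #|parallel_class a|.-1)
    (prefix_word 1 (multinom R (#|E| - #|parallel_class a|).-1)) al.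
Proof.
move=> ab; have a_b : a != b by apply: contraNneq ab => ->; exact: parallel_refl.
rewrite (@colourings_star R _ _ _ b (parallel_class a :\ a)%SET
  (~: (b |: parallel_class a))%SET).
- rewrite (cardsD1 a (parallel_class a)) parallel_class_refl /=.
  rewrite (cardsCs (~: _)%SET) finset.setCK cardsU1 inE (negPf ab) /=.
  rewrite (cardsD1 a (parallel_class a)) parallel_class_refl /=.
  by congr qmul; congr prefix_word; congr multinom; lia.
- by rewrite !inE eq_sym a_b.
- apply/setP => x; rewrite !inE andbT negbK.
  case: (eqVneq x b) => [->|_] /=; first by rewrite (negPf ab) andbF.
  by rewrite andbC.
- apply/fintype.subsetP => x; rewrite !inE negb_or andbT => /andP[-> ax] /=.
  by apply: contraNneq ax => ->; exact: parallel_refl.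
- move=> x y; rewrite !inE !andbT => xa ya; rewrite basis_lt_pair // (negPf xa) /=.
  by rewrite !inE.
Qed.

(** The minimal elements are exactly [a] and [b], since no element is parallel to both. The three
    terms are the possible nonempty lowest levels; when both are in it, an antichain remains. *)
Lemma colourings_base a b al : ~~ parallel M a b -> all (ltn 0) al ->
  (colourings (basis_lt M [set a; b]%SET) [set: E]%SET al)%:R =
  first_level #|E| #|parallel_class a| al + first_level #|E| #|parallel_class b| al +
  prefix_word 2 (multinom R (#|E| - 2)) al.
Proof.
move=> ab; have a_b : a != b by apply: contraNneq ab => ->; exact: parallel_refl.
have ba : ~~ parallel M b a by rewrite parallel_sym.
rewrite /first_level; case: al => [|c al] /=.
  by rewrite !addr0; case: eqP => // E0; have := finset.in_setT a; rewrite E0 inE.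
case: c => // c /= al_gt0; pose lt := basis_lt M [set a; b]%SET.
have bottomE J : bottom_level lt [set: E]%SET c.+1 J =
    [&& J \subset [set a; b]%SET & #|J| == c.+1].
  rewrite /bottom_level finset.subsetT /= andbC; congr (_ && _).
  apply/forall_inP/fintype.subsetP => [J_min x xJ|JS x /JS xS]; last first.
    apply/forall_inP => y _; rewrite /lt basis_lt_pair //.
    by move: xS; rewrite !inE => /orP[] /eqP->;
      rewrite eqxx /= ?orbT ?andbF /= ?(negPf ab) ?(negPf ba) ?parallel_refl ?orbT ?andbF.
  have /forall_inP xmin := J_min x xJ.
  have := xmin a (finset.in_setT a); have := xmin b (finset.in_setT b).
  rewrite /lt !basis_lt_pair // !eqxx !inE /= (negPf a_b) [b == a]eq_sym (negPf a_b) /=.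
  rewrite orbF !negbK => /orP[->|ax]; first by rewrite orbT.
  move=> /orP[->//|bx]; case/negP: ab.
  by apply: (parallel_trans ax); rewrite parallel_sym.
case: c bottomE => [|[|c]] bottomE; rewrite ?mul1r ?mul0r ?addr0 ?add0r.
- rewrite (eq_bigl [pred J | J \in [set [set a]; [set b]]%SET]).
    rewrite big_setU1 ?inE ?big_set1 /=; last first.
      by apply: contraNneq a_b => /finset.set1_inj->.
    by rewrite natrD colourings_without // (finset.setUC [set a]%SET) colourings_without.
  move=> J; rewrite bottomE !inE; apply/andP/orP => [[JS /cards1P[x Jx]]|].
    by move: JS; rewrite Jx finset.sub1set !inE => /orP[] /eqP->; rewrite eqxx; [left|right].
  by case=> /eqP->; rewrite cards1 finset.sub1set !inE eqxx ?orbT.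
- rewrite (eq_bigl (pred1 [set a; b]%SET)) ?big_pred1_eq.
    rewrite (colourings_antichain R).
      by rewrite cardsCs finset.setDE finset.setTI finset.setCK cards2 a_b.
    move=> x y; rewrite !inE andbT negb_or => /andP[xa xb] _.
    by rewrite basis_lt_pair // (negPf xa) (negPf xb).
  move=> J; rewrite bottomE /= eqEcard cards2 a_b; apply: andb_id2l => /subset_leq_card.
  by rewrite cards2 a_b => J2; rewrite eqn_leq J2.
- rewrite big_pred0 // => J; rewrite bottomE; apply/negbTE/andP => -[/subset_leq_card].
  by rewrite cards2 a_b => J2 /eqP Jc; rewrite Jc in J2.
Qed.

End Labeled.

(** The sum of the [h(s)]. The factor counts the pairs of a basis and an element of it in a given
    class of size [s]; the last term belongs to both elements of a basis and is halved. *)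
Definition rank2_coef (la : seq nat) (al : seq nat) : {poly rat} :=
  \sum_(s <- la) (s * (sumn la - s))%:R *
    (first_level {poly rat} (sumn la) s al +
     (2^-1)%:P * prefix_word 2 (multinom {poly rat} (sumn la - 2)) al).

(** Double counting of bases with a chosen element: a basis through [a] is completed by any element
    outside the class of [a]. *)
Lemma word_coef_matroid_qsym (w : {set E} -> E -> nat) al :
  strict_basis_labeling M w -> all (ltn 0) al ->
  word_coef (matroid_qsym M w) al = rank2_coef la al.
Proof.
move=> w_strict al_gt0; rewrite /matroid_qsym word_coef_sum.
pose g s := first_level {poly rat} #|E| s al +
  (2^-1)%:P * prefix_word 2 (multinom {poly rat} (#|E| - 2)) al.
transitivity (\sum_(B in bases M) \sum_(a in B) g #|parallel_class a|).
  apply: eq_bigr => B BM; have [_ w_inj w_lt] := w_strict B BM.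
  rewrite word_coef_poset_qsym //; have [a [b [a_b -> ab]]] := base_unordered BM.
  rewrite colourings_base // big_setU1 ?inE // big_set1 /= /g.
  rewrite addrACA -mulrDl -polyCD -[2^-1 + 2^-1]/(1 : rat) mul1r.
  by [].
rewrite (exchange_big_dep xpredT) //=.
transitivity (\sum_a g #|parallel_class a| *+ (#|E| - #|parallel_class a|)).
  apply: eq_bigr => a _; rewrite sumr_const; congr (_ *+ _).
  transitivity #|[set [set a; b]%SET | b in ~: parallel_class a]%SET|.
    apply: eq_card => B; apply/andP/imsetP => [[BM aB]|[b]].
      have [c [d [cd BE ncd]]] := base_unordered BM.
      move: aB; rewrite BE !inE => /orP[] /eqP->; first by exists d; rewrite ?inE.
      by exists c; rewrite ?inE ?[parallel M d c]parallel_sym // finset.setUC.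
    by rewrite !inE => ab ->; rewrite base_pair ab !inE eqxx.
  rewrite card_in_imset; first by rewrite cardsCs finset.setCK.
  move=> b c; rewrite !inE => ab ac /setP/(_ b); rewrite !inE eqxx orbT.
  by case: eqP => [ba|_ /esym/eqP//]; rewrite ba parallel_refl in ab.
rewrite (parallel_class_sum (fun s => g s *+ (#|E| - s))) /rank2_coef sumn_rank2.
by apply: eq_bigr => s _; rewrite -mulrnA mulr_natl [in RHS]mulnC.
Qed.

End RankTwo.

(** * The infinitesimal character on rank two matroids *)

Section RankTwoFunction.

Lemma qmulC (R : comNzRingType) (A B : seq nat -> R) : qmul A B = qmul B A.
Proof.
apply/funext => al; elim: al A B => [|b al IHal] A B /=; first exact: mulrC.
rewrite (reindex_inj rev_ord_inj) /=; apply: eq_bigr => c _.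
by rewrite IHal subSS subKn // -ltnS.
Qed.

Lemma zero_skipping_filter (R : comNzRingType) (A : seq nat -> R) al :
  zero_skipping A -> A (filter (ltn 0) al) = A al.
Proof.
move=> Az; suff H be : A (be ++ filter (ltn 0) al) = A (be ++ al) by exact: (H [::]).
elim: al be => [//|[|a] al IHal] be /=; first by rewrite IHal Az.
by rewrite -!cat_rcons IHal.
Qed.

Lemma zero_skipping_rank2_coef la : zero_skipping (rank2_coef la).
Proof.
move=> be al; apply: eq_bigr => s _; congr (_ * (_ + _ * _)).
  apply: zero_skipping_prefix_word; apply: zero_skipping_qmul.
    exact: zero_skipping_multinom.
  by apply: zero_skipping_prefix_word; exact: zero_skipping_multinom.
by apply: zero_skipping_prefix_word; exact: zero_skipping_multinom.
Qed.

(** The three terms of [qmul_prefix_word] are the two first-level terms and the sum of the two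
    halves. *)
Lemma rank2_coef_pair s s' al : (0 < s)%N -> (0 < s')%N ->
  rank2_coef [:: s; s'] al = (s * s')%:R *
    qmul (prefix_word 1 (multinom {poly rat} s.-1))
         (prefix_word 1 (multinom {poly rat} s'.-1)) al.
Proof.
move=> s0 s'0; rewrite qmul_prefix_word; try exact: zero_skipping_multinom.
rewrite /rank2_coef /= addn0 !big_cons big_nil /= addKn addnK addr0.
rewrite (mulnC s' s) -mulrDr; congr (_ * _).
rewrite addrACA -mulrDl -polyCD -[2^-1 + 2^-1]/(1 : rat) mul1r.
congr (_ + _); last by rewrite qmul_multinom; congr (prefix_word _ (multinom _ _) _); lia.
rewrite /first_level addKn addnK; congr (_ + _).
by rewrite qmulC.
Qed.

Lemma multinom_neq0 r al : multinom rat r al != 0 -> sumn al = r.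
Proof.
elim: al r => [|d al IHal] r /=; first by case: (r =P 0%N) => [->|]; rewrite ?eqxx.
have [dr|rd] := leqP d r; last by rewrite bin_small // mul0r eqxx.
by rewrite mulf_eq0 negb_or => /andP[_ /IHal->]; rewrite subnKC.
Qed.

Lemma prefix_word_neq0 c r al :
  prefix_word c (multinom rat r) al != 0 -> sumn al = (c + r)%N.
Proof.
elim: al => [//|d al IHal] /=.
have [->|d0] := eqVneq d 0%N; first exact: IHal.
have [->|_] := eqVneq d c; last by rewrite mul0r eqxx.
by rewrite mul1r => /multinom_neq0->.
Qed.

Lemma star_quasisym p :
  (fun m => prefix_word 1 (multinom rat p) (exponents m)) \in quasisym.
Proof.
apply/asboolP; split=> [|m m' -> //]; exists p.+1 => m.
by rewrite mdegreeE => /prefix_word_neq0->.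
Qed.

(* The enumerator of a poset with a minimum and [p] maximal elements, that is,
   of the uniform matroid of rank one on [p.+1] elements up to a factor. *)
Definition star p : QSym := MkQSym (star_quasisym p).

Lemma in_m_star p : in_m (star p).
Proof.
exists p.+2, (fun d => if d == p.+1 then star p else 0); split=> [d m|].
  case: (d =P p.+1) => [->|_]; last by rewrite eqxx.
  by rewrite /= mdegreeE => /prefix_word_neq0->.
rewrite big_nat_recr //= eqxx big1_seq ?add0r // => d.
by rewrite mem_index_iota; case: (d =P p.+1) => // ->; rewrite ltnn andbF.
Qed.

Lemma word_coef_star p :
  word_coef (star p) = prefix_word 1 (multinom {poly rat} p).
Proof.
apply/funext => al; rewrite /word_coef /= exponents_word_monomial.
rewrite zero_skipping_filter; last first.
  by apply: zero_skipping_prefix_word; exact: zero_skipping_multinom.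
have multinomE r be : (multinom rat r be)%:P = multinom {poly rat} r be.
  by elim: be r => [|d be IHbe] r /=; rewrite ?polyCM ?IHbe polyC_natr.
elim: al => [//|d al IHal] /=; case: eqP => // _.
by rewrite polyCM polyC_natr multinomE.
Qed.

Lemma word_monomial_surj m : exists al, m = word_monomial al.
Proof.
pose K := (\max_(i <- finsupp m) i).+1; exists (mkseq m K); apply/fsfunP => i.
rewrite word_monomialE; have [iK|Ki] := ltnP i K; first by rewrite nth_mkseq.
rewrite nth_default ?size_mkseq // fsfun_dflt //; apply/negP => im.
by move: Ki; rewrite leqNgt ltnS leq_bigmax_seq.
Qed.

Lemma m2_rank2_pair s s' (f : QSym) : (0 < s)%N -> (0 < s')%N ->
  word_coef f = rank2_coef [:: s; s'] -> f \in m2.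
Proof.
move=> s0 s'0 fE; apply/asboolP.
(* [in_m2] takes sums of plain products, so the integer factor is realised by repetition. *)
exists (nseq (s * s') (star s.-1, star s'.-1)); split.
  by move=> p /nseqP[-> _]; split; exact: in_m_star.
apply/funext => m; have [al ->] := word_monomial_surj m.
apply: polyC_inj; have := congr1 (fun A => A al) fE; rewrite rank2_coef_pair //.
rewrite /word_coef => ->; rewrite fct_sumE rmorph_sum big_nseq iter_addr addr0.
rewrite /= -[X in _ = X *+ _]/(word_coef (psmul _ _) al) word_coef_psmul.
by rewrite !word_coef_star mulr_natl.
Qed.

(** The contribution of a part [s] to the linear form, up to the sign [(-1) ^+ n], with ['X]
    standing for [1 + t]. *)
Definition lie_poly n s : {poly rat} :=
  (s * (n - s))%:R *
    ('X^((n - s).-1) - 'X^(s.-1) + (s%:R - n%:R * 2^-1)%:P).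

Lemma lie_fun_rank2_coef N la : (sumn la <= N)%N -> all (ltn 0) la ->
  all (gtn (sumn la)) la ->
  lie_fun N ('X - 1) (rank2_coef la) =
  (-1) ^+ sumn la * \sum_(s <- la) lie_poly (sumn la) s.
Proof.
move=> laN la0 la_lt; have L := linear_lie_fun (R := {poly rat}) N ('X - 1).
rewrite /rank2_coef (linear_fun_sum _ _ _ L) mulr_sumr.
apply: eq_big_seq => s sla; have s0 : (0 < s)%N := allP la0 s sla.
have sn : (s < sumn la)%N := allP la_lt s sla.
rewrite (linear_funZ _ _ L) /lie_poly mulrCA; congr (_ * _).
rewrite (linear_funD _ _ L) (linear_funZ _ _ L) /first_level.
rewrite lie_fun_star ?lie_fun_cherry; try lia.
have -> : (s.-1 + (sumn la - s).-1)%N = (sumn la - 2)%N by lia.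
have -> : 1 + ('X - 1) = 'X :> {poly rat} by ring.
have [m nE] : exists m, sumn la = m.+2 by exists (sumn la - 2)%N; lia.
rewrite nE subSS subSS subn0 exprS exprS.
have -> : (s.-1)%:R = (s%:R)%:P - 1 :> {poly rat}.
  by rewrite -[in RHS](prednK s0) polyC_natr -natr1 addrK.
have -> : (s%:R - m.+2%:R * 2^-1)%:P = (s%:R)%:P - 1 - (2^-1)%:P * m%:R :> {poly rat}.
  rewrite -(polyC_natr _ m) -polyC1 -polyCM -!polyCB; congr _%:P.
  by rewrite -[m.+2]addn2 natrD; field.
have E : (2^-1)%:P * (2%:R : {poly rat}) = 1.
  by rewrite -polyC_natr -polyCM mulVf.
(* With [h] kept as an indeterminate, the difference of the two sides is a multiple of [h * 2 - 1],
   which vanishes. *)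
apply/eqP; rewrite -subr_eq0; set h := (2^-1)%:P in E *.
set D := (X in X == 0).
have -> : D = (h * 2%:R - 1) * ((-1) ^+ m * (('X - 1) * 'X^m)).
  by rewrite /D; move: ('X^m) ((-1) ^+ m) => u v; ring.
by rewrite E subrr mul0r.
Qed.

(** Positive degrees only, so the constant [s - n / 2] disappears. *)
Lemma coef_lie_poly n s k : (0 < s)%N -> (s < n)%N ->
  (lie_poly n s)`_k.+1 =
  (s * (n - s))%:R * ((s + k.+2 == n)%:R - (s == k.+2)%:R).
Proof.
move=> s0 sn; rewrite /lie_poly mulr_natl coefMn [RHS]mulr_natl; congr (_ *+ _).
rewrite coefD coefB !coefXn coefC /= addr0.
by congr ((nat_of_bool _)%:R - (nat_of_bool _)%:R); apply/eqP/eqP; lia.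
Qed.

(* [p |-> \int_0^1 p(x) dx - p(1)], for [size p <= n]. *)
Definition degree_fun n (p : {poly rat}) : rat :=
  \sum_(k < n) p`_k * (k.+1%:R^-1 - 1).

Lemma degree_funD n p q : degree_fun n (p + q) = degree_fun n p + degree_fun n q.
Proof.
by rewrite /degree_fun -big_split; apply: eq_bigr => k _; rewrite coefD mulrDl.
Qed.

Lemma degree_funZ n c p : degree_fun n (c%:P * p) = c * degree_fun n p.
Proof.
by rewrite /degree_fun mulr_sumr; apply: eq_bigr => k _; rewrite coefCM mulrA.
Qed.

Lemma degree_fun_sum n (I : Type) (s : seq I) (F : I -> {poly rat}) :
  degree_fun n (\sum_(i <- s) F i) = \sum_(i <- s) degree_fun n (F i).
Proof.
elim: s => [|i s IHs]; last by rewrite !big_cons degree_funD IHs.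
by rewrite !big_nil -(mul0r (0 : {poly rat})) -polyC0 degree_funZ mul0r.
Qed.

Lemma degree_funXn n k : (k < n)%N -> degree_fun n 'X^k = k.+1%:R^-1 - 1.
Proof.
move=> kn; rewrite /degree_fun (bigD1 (Ordinal kn)) //= coefXn eqxx mul1r.
rewrite big1 ?addr0 // => j; rewrite -val_eqE /= coefXn => /negPf->.
by rewrite mul0r.
Qed.

(** Constants have the same integral and value at 1, and the values at 1 of the two powers cancel.
    Their integrals give [1 / (n - s) - 1 / s], to be multiplied by [s (n - s)]. *)
Lemma degree_fun_lie_poly n s : (0 < s)%N -> (s < n)%N ->
  degree_fun n (lie_poly n s) = 2%:R * s%:R - n%:R.
Proof.
move=> s0 sn.
have -> : lie_poly n s = ((s * (n - s))%:R)%:P *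
    ('X^((n - s).-1) + (-1)%:P * 'X^(s.-1) + (s%:R - n%:R * 2^-1)%:P * 'X^0).
  by rewrite /lie_poly polyC_natr polyCN polyC1 mulN1r expr0 mulr1.
rewrite degree_funZ !degree_funD !degree_funZ !degree_funXn ?prednK; try lia.
rewrite invr1 subrr mulr0 addr0 natrM natrB; last exact: ltnW.
have s_neq0 : s%:R != 0 :> rat by rewrite pnatr_eq0; lia.
have ns_neq0 : n%:R - s%:R != 0 :> rat.
  by rewrite -natrB ?pnatr_eq0; lia.
by field; apply/andP.
Qed.

End RankTwoFunction.

(** * The semigroup *)

Lemma barD (f g : QSym) : bar (f + g) = bar f + bar g.
Proof. exact: Quotient.pi_add. Qed.

Lemma bar_eqP (f g : QSym) : bar f = bar g <-> f - g \in m2.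
Proof. by rewrite Quotient.idealrBE; apply: (rwP eqP). Qed.

Section Semigroups.
Variable V : zmodType.
Implicit Types A G : set V.

Lemma semigroup_genD A x y :
  semigroup_gen A x -> semigroup_gen A y -> semigroup_gen A (x + y).
Proof. by move=> Ax Ay B BP; apply: BP.1; [exact: Ax BP | exact: Ay BP]. Qed.

(** The elements with this property form an add-closed set containing [A]. *)
Lemma semigroup_gen_decomp A x : semigroup_gen A x ->
  A x \/ exists y z, [/\ semigroup_gen A y, semigroup_gen A z & x = y + z].
Proof.
have sub : A `<=` semigroup_gen A by exact: sub_gen_smallest.
pose B := [set x | semigroup_gen A x /\
  (A x \/ exists y z, [/\ semigroup_gen A y, semigroup_gen A z & x = y + z])].
suff AB : semigroup_gen A `<=` B by move=> /AB[].
apply: smallest_sub => [u v [Au _] [Av _]|u Au].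
  by split; [exact: semigroup_genD | right; exists u, v].
by split; [exact: sub | left].
Qed.

End Semigroups.

Lemma parts_lt_sumn la : all (ltn 0) la -> (2 <= size la)%N ->
  all (gtn (sumn la)) la.
Proof.
case: la => [//|a [//|b la]] la0 _; apply/allP => s sla /=.
have s_le (be : seq nat) : s \in be -> (s <= sumn be)%N.
  by elim: be => //= c be IHbe; rewrite inE => /predU1P[->|/IHbe]; lia.
case/and3P: la0 => /= a0 b0 _.
by move: sla; rewrite !inE => /or3P[/eqP->|/eqP->|/s_le]; lia.
Qed.

(** * Generation by three-part partitions, minimality and injectivity *)

Section Partitions.
Variables (n : nat) (E : seq nat -> finType).
Variables (M : forall la : seq nat, matroid (E la)).
Variables (w : forall la : seq nat, {set E la} -> E la -> nat).
Hypothesis M_rank2 : forall la : seq nat, is_partition n la -> (2 <= size la)%N ->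
  is_rank_two_matroid (M la) la.
Hypothesis w_strict : forall la : seq nat, is_partition n la -> (2 <= size la)%N ->
  strict_basis_labeling (M la) (@w la).

Let F (la : seq nat) := matroid_qsym (M la) (@w la).

Lemma word_coef_F la : is_partition n la -> (2 <= size la)%N ->
  word_coef (F la) = rank2_coef la.
Proof.
move=> la_n la2; apply/funext => al.
rewrite -(zero_skipping_filter _ (@zero_skipping_word_coef _)).
rewrite -(zero_skipping_filter _ (@zero_skipping_rank2_coef _)).
apply: word_coef_matroid_qsym; [exact: M_rank2 | exact: w_strict | exact: filter_all].
Qed.

(** Merging parts may break the decreasing order, whereas [rank2_coef] does not depend on the
    order. *)
Definition partition_of (la : seq nat) := sort geq la.

Lemma partition_of_is_partition la :
  all (ltn 0) la -> sumn la = n -> is_partition n (partition_of la).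
Proof.
move=> la0 lan; rewrite /is_partition /is_composition.
rewrite (sort_sorted (fun x y => leq_total y x)) all_sort la0 /=.
by rewrite (perm_sumn (permEl (perm_sort geq la))) lan.
Qed.

Lemma word_coef_F_sort la : all (ltn 0) la -> sumn la = n -> (2 <= size la)%N ->
  word_coef (F (partition_of la)) = rank2_coef la.
Proof.
move=> la0 lan la2; rewrite word_coef_F ?size_sort ?partition_of_is_partition //.
apply/funext => al; rewrite /rank2_coef (perm_sumn (permEl (perm_sort geq la))).
by apply: perm_big; rewrite perm_sort.
Qed.

(** Summing [h] over the parts, the two sides differ by [h(a + b) + h(sumn la)]. This is the
    function of a matroid with two classes, which lies in [m2]. *)
Lemma bar_F_split a b la : is_partition n [:: a, b & la] -> (2 <= size la)%N ->
  bar (F [:: a, b & la]) =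
  bar (F (partition_of ((a + b)%N :: la))) + bar (F (partition_of [:: a; b; sumn la])).
Proof.
move=> la_n la2; have := la_n => /and3P[_ /and3P[a0 b0 la0] /eqP lan].
have la_pos : (0 < sumn la)%N.
  by case: (la) la0 la2 => //= c la' /andP[c0 _]; lia.
rewrite /= in a0 b0 lan; have ab0 : (0 < a + b)%N by lia.
have {}la0 : all (ltn 0) la := la0; rewrite -barD; apply/bar_eqP.
have -> : F [:: a, b & la] - (F (partition_of ((a + b)%N :: la)) +
    F (partition_of [:: a; b; sumn la])) = - F (partition_of [:: (a + b)%N; sumn la]).
  apply/eqP; rewrite subr_eq addrC eq_sym subr_eq; apply/eqP/word_coef_inj => al _.
  rewrite !word_coefD (word_coef_F la_n) //.
  rewrite !word_coef_F_sort //= ?a0 ?b0 ?ab0 ?la0 ?la_pos //; try lia.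
  rewrite /rank2_coef /= !big_cons !big_nil !addr0 !addn0 !addnA.
  have -> : (a + b + sumn la)%N = n by lia.
  by ring.
rewrite rpredN; apply: (@m2_rank2_pair (a + b) (sumn la)) => //.
by rewrite word_coef_F_sort //= ?ab0 ?la_pos //; lia.
Qed.

Definition three_part := [set la | is_partition n la /\ size la = 3%N].

(** By induction on the number of parts: splitting yields a partition with one part fewer and one
    with three parts. *)
Lemma bar_F_generated la : is_partition n la -> (3 <= size la)%N ->
  semigroup_gen [set bar (F mu) | mu in three_part] (bar (F la)).
Proof.
have [m] := ubnP (size la); elim: m la => [//|m IHm] la.
have [la3 _ la_n _|la_neq3] := eqVneq (size la) 3%N.
  by apply: sub_gen_smallest; exists la.
case: la la_neq3 => [|a [|b la]] //= la_neq3 la_m la_n la3.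
have := la_n => /and3P[_ /and3P[a0 b0 la0] /eqP lan].
rewrite bar_F_split //; last by lia.
have la_pos : (0 < sumn la)%N.
  by case: (la) la0 la3 => //= c la' /andP[c0 _]; lia.
rewrite /= in a0 b0 lan; have ab0 : (0 < a + b)%N by lia.
have {}la0 : all (ltn 0) la := la0.
apply: semigroup_genD; apply: IHm; rewrite ?size_sort /=; try lia.
all: by apply: partition_of_is_partition; rewrite /= ?a0 ?b0 ?ab0 ?la0 ?la_pos //; lia.
Qed.

(* [k] counts the pieces of a decomposition into three-part matroids. *)
Definition has_degree (x : QSym_mod_m2) (k : nat) := exists f : QSym, x = bar f /\
  forall N, (n <= N)%N ->
    degree_fun n (lie_fun N ('X - 1) (word_coef f)) = k%:R * ((-1) ^+ n.+1 * n%:R).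

(** Summed over the parts, [2 s - n] gives [- n (size la - 2)]. *)
Lemma has_degree_F la : is_partition n la -> (3 <= size la)%N ->
  has_degree (bar (F la)) (size la - 2).
Proof.
move=> la_n la3; have la2 : (2 <= size la)%N by lia.
exists (F la); split=> // N nN; have := la_n => /and3P[_ la0 /eqP lan].
have := parts_lt_sumn la0 la2; rewrite lan => la_lt.
rewrite word_coef_F // lie_fun_rank2_coef ?lan //.
have -> : (-1) ^+ n = ((-1) ^+ n)%:P :> {poly rat} by rewrite rmorphXn /= polyCN.
rewrite degree_funZ degree_fun_sum.
have -> : \sum_(s <- la) degree_fun n (lie_poly n s) =
    \sum_(s <- la) (2%:R * s%:R - n%:R).
  apply: eq_big_seq => s sla; apply: degree_fun_lie_poly; first exact: (allP la0).
  exact: (allP la_lt).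
rewrite big_split /= -mulr_sumr -natr_sum -sumnE lan sumrN.
rewrite (big_const_seq) count_predT iter_addr addr0 natrB // exprS.
by rewrite -[n%:R *+ _]mulr_natl; ring.
Qed.

Lemma has_degreeD x y k l : has_degree x k -> has_degree y l -> has_degree (x + y) (k + l).
Proof.
move=> [f [-> fk]] [g [-> gl]]; exists (f + g); split=> [|N nN]; first by rewrite barD.
rewrite word_coefD (linear_funD _ _ (linear_lie_fun _ _)) degree_funD fk // gl //.
by rewrite natrD mulrDl.
Qed.

(** The truncation must pass a bound attached to the difference in [m2]; the maximum with [n] keeps
    the explicit values available. *)
Lemma lie_fun_bar (f g : QSym) : bar f = bar g -> exists2 N, (n <= N)%N &
  lie_fun N ('X - 1) (word_coef f) = lie_fun N ('X - 1) (word_coef g).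
Proof.
move=> /bar_eqP/(lie_fun_m2 ('X - 1))[N0 N0P].
exists (maxn n N0); first exact: leq_maxl.
have := N0P _ (leq_maxr n N0); set N := maxn n N0.
move=> fg0; rewrite -[in LHS](subrK g f).
by rewrite word_coefD (linear_funD _ _ (linear_lie_fun _ _)) fg0 add0r.
Qed.

Lemma has_degree_unique x k l : (0 < n)%N -> has_degree x k -> has_degree x l -> k = l.
Proof.
move=> n0 [f [xf fk]] [g [xg gl]]; have [|N nN fg] := @lie_fun_bar f g.
  by rewrite -xf.
have := fk N nN; rewrite fg gl // => /mulIf kl; apply/eqP.
rewrite -(eqr_nat rat) eq_sym; apply/eqP/kl.
by rewrite mulf_neq0 ?signr_eq0 // pnatr_eq0 -lt0n.
Qed.

Lemma lie_poly_sum_bar la mu : is_partition n la -> (2 <= size la)%N ->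
  is_partition n mu -> (2 <= size mu)%N -> bar (F la) = bar (F mu) ->
  \sum_(s <- la) lie_poly n s = \sum_(s <- mu) lie_poly n s.
Proof.
move=> la_n la2 mu_n mu2 /lie_fun_bar[N nN].
have := la_n => /and3P[_ la0 /eqP lan]; have := mu_n => /and3P[_ mu0 /eqP mun].
rewrite !word_coef_F // !lie_fun_rank2_coef ?lan ?mun //.
- by apply: mulfI; rewrite signr_eq0.
- by have := parts_lt_sumn mu0 mu2; rewrite mun.
- by have := parts_lt_sumn la0 la2; rewrite lan.
Qed.

(** The smallest part [c] contributes positively in degree [n - c - 1]. If [c < c'], no part on the
    other side does so, and a positive number would equal a nonpositive one. When [c = c'], these
    terms cancel and [b] is treated alike. *)
Lemma lie_poly_inj3 a b c a' b' c' :
  (0 < c <= b)%N -> (b <= a)%N -> (a + b + c = n)%N ->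
  (0 < c' <= b')%N -> (b' <= a')%N -> (a' + b' + c' = n)%N ->
  \sum_(s <- [:: a; b; c]) lie_poly n s = \sum_(s <- [:: a'; b'; c']) lie_poly n s ->
  (c' <= c)%N /\ (c = c' -> b' <= b)%N.
Proof.
move=> cb ba abc cb' ba' abc' /polyP H.
have coefE k a1 b1 c1 : (0 < c1 <= b1)%N -> (b1 <= a1)%N -> (a1 + b1 + c1 = n)%N ->
  (\sum_(s <- [:: a1; b1; c1]) lie_poly n s)`_k.+1 =
  (a1 * (n - a1))%:R * ((a1 + k.+2 == n)%:R - (a1 == k.+2)%:R) +
  ((b1 * (n - b1))%:R * ((b1 + k.+2 == n)%:R - (b1 == k.+2)%:R) +
   (c1 * (n - c1))%:R * ((c1 + k.+2 == n)%:R - (c1 == k.+2)%:R)).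
  by move=> *; rewrite !big_cons big_nil addr0 !coefD !coef_lie_poly //; lia.
have {}H k := H k.+1.
have contra (x y : nat) : (0 < x)%N -> x%:R = - y%:R :> rat -> False.
  by move=> x0 /eqP; rewrite -subr_eq0 opprK -natrD pnatr_eq0; lia.
split=> [|cc']; rewrite leqNgt; apply/negP.
  (* [H k] compares coefficients of degree [k.+1], here [n - c - 1]. *)
  move=> cc'; have := H (n - c - 2)%N; rewrite !coefE //.
  have -> : (n - c - 2).+2 = (n - c)%N by lia.
  have -> : (a == n - c)%N = false by lia.
  have -> : (b == n - c)%N = false by lia.
  have -> : (c == n - c)%N = false by lia.
  have -> : (c + (n - c) == n)%N = true by lia.
  have -> : (a' + (n - c) == n)%N = false by lia.
  have -> : (b' + (n - c) == n)%N = false by lia.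
  have -> : (c' + (n - c) == n)%N = false by lia.
  rewrite !subr0 !sub0r !mulrN -!opprD -!natrM -!natrD; apply: contra.
  have c_pos : (0 < c * (n - c))%N by rewrite muln_gt0; lia.
  by rewrite !addn_gt0 /= muln1 c_pos !orbT.
move=> bb'; have := H (n - b - 2)%N; rewrite !coefE //.
have -> : (n - b - 2).+2 = (n - b)%N by lia.
rewrite cc' addrA [RHS]addrA => /addIr.
have -> : (a == n - b)%N = false by lia.
have -> : (b == n - b)%N = false by lia.
have -> : (b + (n - b) == n)%N = true by lia.
have -> : (a' + (n - b) == n)%N = false by lia.
have -> : (b' + (n - b) == n)%N = false by lia.
rewrite !subr0 !sub0r !mulrN -!opprD -!natrM -!natrD; apply: contra.
have b_pos : (0 < b * (n - b))%N by rewrite muln_gt0; lia.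
by rewrite addn_gt0 /= muln1 b_pos orbT.
Qed.

Lemma three_partP la : three_part la -> exists a b c,
  [/\ la = [:: a; b; c], (0 < c <= b)%N, (b <= a)%N & (a + b + c = n)%N].
Proof.
case=> + la3; case: la la3 => [|a [|b [|c []]]] //= _.
case/andP=> /= /and3P[ba cb _] /andP[/= /and4P[_ _ c0 _] /eqP abc].
by exists a, b, c; split=> //; [rewrite cb andbT | lia].
Qed.

Lemma bar_F_inj : {in three_part &, injective (fun la => bar (F la))}.
Proof.
move=> la mu; rewrite !inE => la3 mu3 la_mu.
have H : \sum_(s <- la) lie_poly n s = \sum_(s <- mu) lie_poly n s.
  case: la3 mu3 => [la_n la3] [mu_n mu3].
  by apply: lie_poly_sum_bar; rewrite ?la3 ?mu3.
have [a [b [c [laE cb ba abc]]]] := three_partP la3.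
have [a' [b' [c' [muE cb' ba' abc']]]] := three_partP mu3.
rewrite laE muE in H *.
have [c'c b'b] := lie_poly_inj3 cb ba abc cb' ba' abc' H.
have [cc' bb'] := lie_poly_inj3 cb' ba' abc' cb ba abc (esym H).
have c_eq : c = c' by apply/eqP; rewrite eqn_leq cc' c'c.
have b_eq : b = b' by apply/eqP; rewrite eqn_leq bb' // b'b.
by rewrite b_eq c_eq; congr [:: _; _; _]; lia.
Qed.

Lemma hilbert_basis_three_part
    (S := [set bar (F la) | la in [set la | is_partition n la /\ (3 <= size la)%N]]) :
  is_hilbert_basis (semigroup_gen S) [set bar (F la) | la in three_part].
Proof.
have basis_sub : [set bar (F la) | la in three_part] `<=` S.
  by move=> _ [la [la_n la3] <-]; exists la => //; split=> //; rewrite la3.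
split.
  apply/seteqP; split; apply: smallest_sub.
  - by move=> x y; exact: semigroup_genD.
  - by move=> x /basis_sub Sx; exact: sub_gen_smallest.
  - by move=> x y; exact: semigroup_genD.
  - by move=> _ [la [la_n la3] <-]; exact: bar_F_generated.
move=> G GS x Hx; have Sx : semigroup_gen G x.
  by rewrite GS; apply: sub_gen_smallest; exact: basis_sub.
(* If [x] is not in [G], it is a sum of two elements of the semigroup. Both have positive degree, so
   [x] would have degree at least two, but its degree is one. *)
have [//|[y [z [Gy Gz xE]]]] := semigroup_gen_decomp Sx.
have deg u : semigroup_gen S u -> exists2 k, (0 < k)%N & has_degree u k.
  move: u; apply: smallest_sub => [u v [k k0 uk] [l l0 vl]|_ [la [la_n la3] <-]].
    by exists (k + l)%N; [rewrite addn_gt0 k0 | exact: has_degreeD].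
  by exists (size la - 2)%N; [lia | exact: has_degree_F].
rewrite GS in Gy Gz; have [k k0 yk] := deg y Gy; have [l l0 zl] := deg z Gz.
case: Hx => la [la_n la3] laE.
have n0 : (0 < n)%N.
  by have [a [b [c [_ cb _ abc]]]] := three_partP (conj la_n la3); lia.
have la_deg := has_degree_F la_n; rewrite laE la3 xE in la_deg.
by have := has_degree_unique n0 (la_deg isT) (has_degreeD yk zl); lia.
Qed.

End Partitions.

Unset Implicit Arguments.
Set Strict Implicit.

Theorem corollary6p7 (n : nat) (E : seq nat -> finType)
    (M : forall la : seq nat, matroid (E la))
    (w : forall la : seq nat, {set E la} -> E la -> nat)
    (hM : forall la : seq nat, is_partition n la -> (2 <= size la)%N ->
       is_rank_two_matroid (M la) la)
    (hw : forall la : seq nat, is_partition n la -> (2 <= size la)%N ->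
       strict_basis_labeling (M la) (w la)) :
  let barF := fun la : seq nat => bar (matroid_qsym (M la) (w la)) in
  let S := [set barF la | la in [set la | is_partition n la /\ (3 <= size la)%N]] in
  exists H : set QSym_mod_m2,
    is_hilbert_basis (semigroup_gen S) H /\
    set_bij [set la | is_partition n la /\ size la = 3%N] H barF.
Proof.
move=> barF S; exists [set barF la | la in three_part n]; split.
  exact: (hilbert_basis_three_part hM hw).
split; first by move=> la la3; exists la.
- exact: (bar_F_inj hM hw).
- by move=> _ [la la3 <-]; exists la.
Qed.
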